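(* Let $(M,\omega)$ be a symplectic manifold of dimension $2n$ and $0\le p\le n$. For $A_j\in F^p\Omega^j=\mathcal F_p^j$, $A_k\in F^p\Omega^k=\mathcal F_p^k$ and $\bar A_k\in\overline{F^p\Omega^k}=\mathcal F_p^{2n+2p+1-k}$ with $0\le j,k\le n+p$, the following Leibniz rules hold: (i) $d_+(A_j\times A_k)=d_jA_j\times A_k+(-1)^jA_j\times d_kA_k$ if $j+k<n+p$; (ii) $-\partial_+\partial_-(A_j\times A_k)=d_jA_j\times A_k+(-1)^jA_j\times d_kA_k$ if $j+k=n+p$; (iii) $-d_-(A_j\times A_k)=d_jA_j\times A_k+(-1)^jA_j\times d_kA_k$ if $j+k>n+p$; (iv) $-d_-(A_j\times\bar A_k)=d_jA_j\times\bar A_k+(-1)^jA_j\times(-d_-\bar A_k)$ if $j\le k$. Here $d_j=d_+$ if $j<n+p$ and $d_j=-\partial_+\partial_-:F^p\Omega^{n+p}\to\overline{F^p\Omega^{n+p}}$ if $j=n+p$ (likewise for $d_k$).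
   Context: $\Omega^k$ denotes the smooth real $k$-forms on $M$ (zero for $k<0$ or $k>2n$), and $L(A)=\omega\wedge A$. For $0\le s\le n$, $\mathcal P^s=\{B\in\Omega^s: L^{n+1-s}B=0\}$ is the space of primitive $s$-forms; set $\mathcal P^s=0$ for other $s$. Every $A_k\in\Omega^k$ has a unique Lefschetz decomposition $A_k=\sum_{\max(0,k-n)\le r\le\lfloor k/2\rfloor}L^rB_{k-2r}$ with $B_{k-2r}\in\mathcal P^{k-2r}$. Reflection: $*_r$ is the linear operator with $*_r(L^rB_s)=L^{n-r-s}B_s$ for $B_s\in\mathcal P^s$, $0\le r\le n-s$. Negative powers: for $q>0$, $L^{-q}A_k=\sum_{r\ge q}L^{r-q}B_{k-2r}$. Projection: $\Pi^p A_k=\sum_{r\le p}L^rB_{k-2r}$. Filtered forms: $F^p\Omega^k=\Pi^p\Omega^k$ (nonzero only for $0\le k\le n+p$; $F^p\Omega^{n+p}=L^p\mathcal P^{n-p}$). Operators $\partial_\pm$: for $B_s\in\mathcal P^s$ write uniquely $dB_s=\partial_+B_s+\omega\wedge\partial_-B_s$ with $\partial_\pm B_s\in\mathcal P^{s\pm1}$, and set $\partial_\pm(L^rB_s)=L^r\partial_\pm B_s$. Operators $d_\pm$: $d_+=\Pi^p\circ d:F^p\Omega^k\to F^p\Omega^{k+1}$ and $d_-=*_r\,d\,*_r:F^p\Omega^k\to F^p\Omega^{k-1}$. Graded space: $\mathcal F_p=\bigoplus_{j=0}^{2n+2p+1}\mathcal F_p^j$ with $\mathcal F_p^j=F^p\Omega^j$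 for $0\le j\le n+p$ and $\mathcal F_p^{2n+2p+1-j}=\overline{F^p\Omega^j}$ for $0\le j\le n+p$, where $\overline{F^p\Omega^j}$ is a second copy of $F^p\Omega^j$ whose elements are written $\bar A_j$. Product $\times:\mathcal F_p^j\otimes\mathcal F_p^k\to\mathcal F_p^{j+k}$: for $j+k\le n+p$, $A_j\times A_k=\Pi^p(A_j\wedge A_k)\in F^p\Omega^{j+k}$; for $j+k>n+p$, $A_j\times A_k=\Pi^p*_r\big[-d\,L^{-(p+1)}(A_j\wedge A_k)+(L^{-(p+1)}dA_j)\wedge A_k+(-1)^jA_j\wedge(L^{-(p+1)}dA_k)\big]\in\overline{F^p\Omega^{2n+2p+1-j-k}}$; $A_j\times\bar A_k=(-1)^j*_r\big(A_j\wedge( *_r\bar A_k)\big)\in\overline{F^p\Omega^{k-j}}$; $\bar A_j\times A_k=*_r\big(( *_r\bar A_j)\wedge A_k\big)\in\overline{F^p\Omega^{j-k}}$; $\bar A_j\times\bar A_k=0$. *)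

(* Defs.v *)
From HB Require Import structures.
From mathcomp Require Import all_boot all_order all_algebra.
From mathcomp Require Import all_classical all_reals all_analysis.
Set Implicit Arguments.
Unset Strict Implicit.
Unset Printing Implicit Defensive.
Import Order.TTheory GRing.Theory Num.Theory.
Import numFieldNormedType.Exports.
Local Open Scope ring_scope.

(* The exterior algebra of (R^m)^*: [a S] is the coefficient of
   dx_{s_1} /\ ... /\ dx_{s_k}, where S = {s_1 < ... < s_k}. *)
Notation extalg R m := {ffun {set 'I_m} -> R}.

Section ExteriorAlgebra.
Context {R : realType} {m : nat}.
Implicit Types (a b : extalg R m) (S T : {set 'I_m}).

Definition inversions S T : nat :=
  #|[set st : 'I_m * 'I_m | [&& st.1 \in S, st.2 \in T & (st.2 < st.1)%N]]%SET|.

(* dx_S /\ dx_T = (-1)^(inversions S T) dx_(S :|: T) for disjoint S, T. *)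
Definition ext_wedge a b : extalg R m :=
  [ffun U : {set 'I_m} => \sum_(S : {set 'I_m} | S \subset U)
     (-1) ^+ inversions S (U :\: S) * a S * b (U :\: S)].

Definition ext_one : extalg R m := [ffun S => (S == finset.set0)%:R].

Definition ext_dx (i : 'I_m) : extalg R m := [ffun S => (S == [set i]%SET)%:R].

Definition ext_homogeneous (k : nat) a := forall S, #|S| != k -> a S = 0.

(* Pullback along a linear map R^m -> R^m with Jacobian matrix
   J i l = dy_i / dx_l : dy_i is sent to \sum_l J i l dx_l.  The enumeration of
   a set of ordinals is increasing. *)
Definition ext_pullback (J : 'M[R]_m) a : extalg R m :=
  \sum_(S : {set 'I_m}) a S *:
    \big[ext_wedge/ext_one]_(i <- enum S) \sum_(l < m) J i l *: ext_dx l.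

(* The Gram matrix of the bilinear form given by the 2-form part of a. *)
Definition ext_gram a : 'M[R]_m :=
  \matrix_(i, l) if (i < l)%N then a [set i; l]%SET
                 else if (l < i)%N then - a [set i; l]%SET else 0.

End ExteriorAlgebra.

Local Open Scope classical_set_scope.

Section Smooth.
Context {R : realType} {m : nat}.

Definition partial (i : 'I_m) (f : 'rV[R]_m -> R) : 'rV[R]_m -> R :=
  fun x => 'D_(delta_mx 0 i) f x.

(* C^oo on the open set U: all iterated partial derivatives are Frechet
   differentiable on U. *)
Definition smooth_on (U : set 'rV[R]_m) (f : 'rV[R]_m -> R) :=
  forall (s : seq 'I_m) x, U x -> differentiable (foldr partial f s) x.

End Smooth.

(* Smooth manifolds without boundary, given by a smooth atlas. *)
Record manifold (R : realType) (m : nat) := Manifold {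
  mcarrier :> topologicalType;
  chart : Type;
  chart_dom : chart -> set mcarrier;
  chart_coord : chart -> mcarrier -> 'rV[R]_m;
  chart_param : chart -> 'rV[R]_m -> mcarrier;
  manifold_hausdorff : hausdorff_space mcarrier;
  manifold_second_countable : @second_countable mcarrier;
  chart_cover : forall x, exists c, chart_dom c x;
  chart_dom_open : forall c, open (chart_dom c);
  chart_img_open : forall c, open (chart_coord c @` chart_dom c);
  chart_coordK : forall c x, chart_dom c x ->
    chart_param c (chart_coord c x) = x;
  chart_coord_continuous : forall c,
    {within chart_dom c, continuous (chart_coord c)};
  chart_param_continuous : forall c,
    {within chart_coord c @` chart_dom c, continuous (chart_param c)};
  chart_transition_smooth : forall (c c' : chart) (i : 'I_m),
    smooth_on (chart_coord c @` (chart_dom c `&` chart_dom c'))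
      (fun y => chart_coord c' (chart_param c y) 0 i) }.

Section Forms.
Context {R : realType} {m : nat} {M : manifold R m}.

(* Coordinate expressions of forms: [A c x] is the value at x, written in the
   coordinates of the chart c.  It is only meaningful on the domain of c, and is
   normalised to 0 elsewhere. *)
Definition form_field : Type := chart M -> M -> extalg R m.
HB.instance Definition _ := GRing.Lmodule.on form_field.

Implicit Types (A B : form_field) (c : chart M) (x : M).

Definition transition_jacobian c c' x : 'M[R]_m :=
  \matrix_(i, l)
    partial l (fun y => chart_coord c' (chart_param c y) 0 i) (chart_coord c x).

Record is_form (k : nat) A : Prop := IsForm {
  form_out : forall c x, ~ chart_dom c x -> A c x = 0;
  form_degree : forall c x, ext_homogeneous k (A c x);
  form_smooth : forall c (S : {set 'I_m}),
    smooth_on (chart_coord c @` chart_dom c)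
      (fun y => A c (chart_param c y) S);
  form_compatible : forall c c' x, chart_dom c x -> chart_dom c' x ->
    A c x = ext_pullback (transition_jacobian c c' x) (A c' x) }.

Definition wedge A B : form_field := fun c x => ext_wedge (A c x) (B c x).

Definition d A : form_field := fun c x =>
  if x \in chart_dom c then
    \sum_(i < m) ext_wedge (ext_dx i)
      [ffun S => partial i (fun y => A c (chart_param c y) S) (chart_coord c x)]
  else 0.

Record is_symplectic (w : form_field) : Prop := IsSymplectic {
  symplectic_form : is_form 2 w;
  symplectic_closed : d w = 0;
  symplectic_nondegenerate : forall c x, chart_dom c x -> forall u : 'rV[R]_m,
    (forall v : 'rV[R]_m, u *m ext_gram (w c x) *m v^T = 0) -> u = 0 }.

End Forms.
Arguments form_field {R m} M.

Record symplectic_manifold (R : realType) (n : nat) := SymplecticManifold {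
  smanifold :> manifold R (2 * n);
  omega : form_field smanifold;
  omega_symplectic : is_symplectic omega }.
Arguments omega {R n} _.

(* The component of degree a of the graded space F_p consists of filtered
   a-forms if a <= n + p, and of barred filtered (bardeg n p a)-forms if
   n + p < a <= 2n + 2p + 1. *)
Definition bardeg (n p a : nat) : nat := (2 * n + 2 * p + 1 - a)%N.

Section Lefschetz.
Context {R : realType} {n : nat} {M : symplectic_manifold R n}.
Implicit Types (A B : form_field M) (k s p q r : nat).

Definition L A : form_field M := wedge (omega M) A.

Definition primitive s B : Prop :=
  if (s <= n)%N then is_form s B /\ iter (n.+1 - s) L B = 0 else B = 0.

Definition is_lefschetz k A (B : nat -> form_field M) : Prop :=
  [/\ forall r, (k - n <= r <= k./2)%N -> primitive (k - 2 * r) (B r),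
      forall r, ~~ (k - n <= r <= k./2)%N -> B r = 0
    & A = \sum_(k - n <= r < k./2.+1) iter r L (B r)].

(* [lefschetz k A r] is the component B_{k-2r} of the k-form A; the
   decomposition exists and is unique for every k-form. *)
Definition lefschetz k A : nat -> form_field M :=
  xget (fun=> 0) [set B | is_lefschetz k A B].

(* In the operators below the subscript k is the degree of the argument. *)

Definition rstar k A : form_field M :=
  \sum_(k - n <= r < k./2.+1) iter (n - r - (k - 2 * r)) L (lefschetz k A r).

Definition Lneg q k A : form_field M :=
  \sum_(k - n <= r < k./2.+1 | (q <= r)%N) iter (r - q) L (lefschetz k A r).

Definition Pi p k A : form_field M :=
  \sum_(k - n <= r < k./2.+1 | (r <= p)%N) iter r L (lefschetz k A r).

Definition filtered p k A : Prop := exists2 A', is_form k A' & A = Pi p k A'.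

(* dB = X + omega /\ Y with X in P^(s+1) and Y in P^(s-1), where P^(-1) = 0. *)
Definition is_dsplit s B (XY : form_field M * form_field M) : Prop :=
  [/\ primitive s.+1 XY.1,
      (if s is s'.+1 then primitive s' XY.2 else XY.2 = 0)
    & d B = XY.1 + wedge (omega M) XY.2].

Definition dsplit s B : form_field M * form_field M :=
  xget (0, 0) [set XY | is_dsplit s B XY].

Definition partial_plus k A : form_field M :=
  \sum_(k - n <= r < k./2.+1)
    iter r L (dsplit (k - 2 * r) (lefschetz k A r)).1.

Definition partial_minus k A : form_field M :=
  \sum_(k - n <= r < k./2.+1)
    iter r L (dsplit (k - 2 * r) (lefschetz k A r)).2.

Definition d_plus p k A : form_field M := Pi p k.+1 (d A).

Definition d_minus k A : form_field M := rstar (2 * n - k).+1 (d (rstar k A)).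

(* The map F_p^a -> F_p^(a+1) for a <= n + p; in degree n + p its values are
   barred. *)
Definition dF p a A : form_field M :=
  if (a < n + p)%N then d_plus p a A
  else - partial_plus a.-1 (partial_minus a A).

(* The product F_p^a x F_p^b -> F_p^(a+b). *)
Definition times p a b A B : form_field M :=
  if (a <= n + p)%N then
    if (b <= n + p)%N then
      if (a + b <= n + p)%N then Pi p (a + b) (wedge A B)
      else Pi p (bardeg n p (a + b)) (rstar (a + b - (2 * p + 1))
        (- d (Lneg p.+1 (a + b) (wedge A B))
         + wedge (Lneg p.+1 a.+1 (d A)) B
         + (-1) ^+ a *: wedge A (Lneg p.+1 b.+1 (d B))))
    else let k := bardeg n p b in
      (-1) ^+ a *: rstar (a + (2 * n - k)) (wedge A (rstar k B))
  else
    if (b <= n + p)%N then let k := bardeg n p a in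
      rstar (2 * n - k + b) (wedge (rstar k A) B)
    else 0.

End Lefschetz.

(* Main.v *)
(** The proof compares F_p with the cone of L^(p+1): the graded algebra of elements
    a + theta b with theta of odd degree 2p+1, theta^2 = 0 and d theta = omega^(p+1). Write Q for
    L^-(p+1). The map i sending A to A - theta Q(dA) and a barred form B to - theta *_r B, and
    the map pi sending a + theta b to Pi^p a in degrees at most n+p and to
    - Pi^p *_r (b + d Q a) above, are chain maps up to the identification of the differential
    of F_p with d_+, - d_+ d_- and - d_-, and A x B = pi(i(A) i(B)).
    Rules (i)-(iii) therefore follow from the Leibniz rule of the cone; (iv) is direct because
    L^(p+1) kills *_r B. The only inputs from Lefschetz theory are Pi^p L^(p+1) = 0,
    1 = Pi^p + L^(p+1) Q, and the fact that 1 - Q L^(p+1) = *_r Pi^p *_r is the projection onto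
    the kernel of L^(p+1), which vanishes in degrees below n-p.

    The Lefschetz decomposition itself is obtained on forms, without any dimension count,
    from the commutator of L with the contraction Lam by the Poisson bivector. That Lam
    preserves forms uses the smoothness of the inverse of the matrix of omega and its
    transformation rule; that d does uses the chain rule and the symmetry of second
    derivatives. *)
Require Import Defs.
From HB Require Import structures.
From mathcomp Require Import all_boot all_order all_algebra.
From mathcomp Require Import all_classical all_reals all_analysis.
From mathcomp Require Import ring lra zify.
Import Order.TTheory GRing.Theory Num.Theory.
Import numFieldNormedType.Exports.
Local Open Scope classical_set_scope.
Local Open Scope ring_scope.

Set Implicit Arguments.
Unset Strict Implicit.
Unset Printing Implicit Defensive.

(** * The exterior algebra *)

Section ExteriorAlgebraTheory.
Local Open Scope bool_scope.
Local Open Scope set_scope.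
Local Open Scope ring_scope.
Context {R : realType} {m : nat}.
Implicit Types (a b c : extalg R m) (S T U W : {set 'I_m}) (i j l : 'I_m).

Definition ext_base S : extalg R m := [ffun T => (T == S)%:R].

Lemma ext_expand a : a = \sum_S a S *: ext_base S.
Proof.
apply/ffunP => U; rewrite sum_ffunE (bigD1 U) //= big1 => [|S SU].
  by rewrite !ffunE eqxx /GRing.scale /= mulr1 addr0.
by rewrite !ffunE eq_sym (negPf SU) /GRing.scale /= mulr0.
Qed.

Lemma inversionsE S T :
  inversions S T = (\sum_(i in S) \sum_(j in T) (j < i)%N)%N.
Proof.
rewrite /inversions -sum1_card pair_big_dep /= [RHS]big_mkcond /= big_mkcond.
apply: eq_bigr => -[x y] _ /=; rewrite inE /=.
by case: (x \in S); case: (y \in T); case: (y < x)%N.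
Qed.

Lemma inversionsUl S T W : [disjoint S & T] ->
  inversions (S :|: T) W = (inversions S W + inversions T W)%N.
Proof.
move=> dST; by rewrite !inversionsE -bigU //=; apply: eq_bigl => x; rewrite !inE.
Qed.

Lemma inversionsUr S T W : [disjoint T & W] ->
  inversions S (T :|: W) = (inversions S T + inversions S W)%N.
Proof.
move=> dTW; rewrite !inversionsE -big_split /=; apply: eq_bigr => x _.
by rewrite -bigU //=; apply: eq_bigl => y; rewrite !inE.
Qed.

Lemma inversions_swap S T : [disjoint S & T] ->
  (inversions S T + inversions T S)%N = (#|S| * #|T|)%N.
Proof.
move=> dST; rewrite !inversionsE [X in (_ + X)%N]exchange_big /= -big_split /=.
rewrite -sum_nat_const; apply: eq_bigr => x xS; rewrite -big_split /=.
rewrite -sum1_card; apply: eq_bigr => y yT.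
case: ltngtP => // /val_inj xy; move: dST; rewrite disjoint_subset.
by move=> /fintype.subsetP/(_ _ xS); rewrite inE -xy yT.
Qed.

Lemma ext_wedge_linear a : linear (ext_wedge a).
Proof.
move=> k b c; apply/ffunP => U; rewrite !ffunE scaler_sumr -big_split /=.
by apply: eq_bigr => S _; rewrite !ffunE /GRing.scale /=; ring.
Qed.
HB.instance Definition _ a :=
  GRing.isLinear.Build R (extalg R m) (extalg R m) _ (ext_wedge a) (ext_wedge_linear a).

Definition ext_wedger b a := ext_wedge a b.

Lemma ext_wedger_linear b : linear (ext_wedger b).
Proof.
move=> k a c; apply/ffunP => U; rewrite !ffunE scaler_sumr -big_split /=.
by apply: eq_bigr => S _; rewrite !ffunE /GRing.scale /=; ring.
Qed.
HB.instance Definition _ b :=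
  GRing.isLinear.Build R (extalg R m) (extalg R m) _ (ext_wedger b) (ext_wedger_linear b).

Lemma ext_wedgeDl a b c : ext_wedge (a + b) c = ext_wedge a c + ext_wedge b c.
Proof. exact: (linearD (ext_wedger c)). Qed.

Lemma ext_wedgeDr a b c : ext_wedge a (b + c) = ext_wedge a b + ext_wedge a c.
Proof. exact: linearD. Qed.

Lemma ext_wedgeZl k a b : ext_wedge (k *: a) b = k *: ext_wedge a b.
Proof. by rewrite -[LHS]/(ext_wedger b (k *: a)) linearZ. Qed.

Lemma ext_wedgeZr k a b : ext_wedge a (k *: b) = k *: ext_wedge a b.
Proof. by rewrite linearZ. Qed.

Lemma ext_wedge0l b : ext_wedge 0 b = 0.
Proof. exact: (linear0 (ext_wedger b)). Qed.

Lemma ext_wedge0r a : ext_wedge a 0 = 0.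
Proof. exact: linear0. Qed.

Lemma ext_wedgeNl a b : ext_wedge (- a) b = - ext_wedge a b.
Proof. exact: (linearN (ext_wedger b)). Qed.

Lemma ext_wedgeNr a b : ext_wedge a (- b) = - ext_wedge a b.
Proof. exact: linearN. Qed.

Lemma ext_wedge_suml I (r : seq I) (P : pred I) (F : I -> extalg R m) b :
  ext_wedge (\sum_(x <- r | P x) F x) b = \sum_(x <- r | P x) ext_wedge (F x) b.
Proof. exact: (linear_sum (ext_wedger b)). Qed.

Lemma ext_wedge_sumr I (r : seq I) (P : pred I) (F : I -> extalg R m) a :
  ext_wedge a (\sum_(x <- r | P x) F x) = \sum_(x <- r | P x) ext_wedge a (F x).
Proof. exact: linear_sum. Qed.

Lemma ext_wedge_base S T : ext_wedge (ext_base S) (ext_base T) =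
  if [disjoint S & T] then (-1) ^+ inversions S T *: ext_base (S :|: T) else 0.
Proof.
apply/ffunP => U; rewrite !ffunE; under eq_bigr do rewrite !ffunE.
have [SU|SU] := boolP (S \subset U); last first.
  rewrite big1 => [|W WU]; last first.
    case: eqP => [WS|_]; last by rewrite mulr0 mul0r.
    by rewrite -WS WU in SU.
  case: ifP => _; rewrite !ffunE //; case: eqP => [UE|_]; last by rewrite [RHS]mulr0.
  by rewrite UE finset.subsetUl in SU.
rewrite (bigD1 S) //= big1 ?addr0 => [|W /andP[_ WS]]; last first.
  by rewrite (negPf WS) mulr0 mul0r.
rewrite eqxx mulr1.
have -> : (U :\: S == T) = [disjoint S & T] && (U == S :|: T).
  apply/eqP/andP => [<-|[dST /eqP ->]].
    rewrite -setI_eq0 finset.setIDA finset.setIC -finset.setIDA finset.setDv finset.setI0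
      eqxx; split => //.
    by rewrite -{1}(finset.setIidPr SU) finset.setID.
  by rewrite finset.setDUl finset.setDv finset.set0U; apply/finset.setDidPl;
    rewrite disjoint_sym.
have [dST|] := boolP [disjoint S & T]; rewrite /= !ffunE ?mulr0 // /GRing.scale /=.
have [->|_] := eqVneq U (S :|: T); last by rewrite !mulr0.
rewrite finset.setDUl finset.setDv finset.set0U;
  have/finset.setDidPl -> // : [disjoint T & S].
by rewrite disjoint_sym.
Qed.

Lemma ext_wedgeA a b c :
  ext_wedge a (ext_wedge b c) = ext_wedge (ext_wedge a b) c.
Proof.
rewrite [a]ext_expand !ext_wedge_suml; apply: eq_bigr => S _; rewrite !ext_wedgeZl;
  congr (_ *: _).
rewrite [b]ext_expand !(ext_wedge_suml, ext_wedge_sumr); apply: eq_bigr => T _.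
rewrite !(ext_wedgeZl, ext_wedgeZr); congr (_ *: _).
rewrite [c]ext_expand !(ext_wedge_suml, ext_wedge_sumr); apply: eq_bigr => W _.
rewrite !(ext_wedgeZl, ext_wedgeZr); congr (_ *: _).
rewrite !ext_wedge_base.
have dU : [disjoint S & (T :|: W)] = [disjoint S & T] && [disjoint S & W].
  by rewrite -!setI_eq0 finset.setIUr finset.setU_eq0.
have dV : [disjoint (S :|: T) & W] = [disjoint S & W] && [disjoint T & W].
  by rewrite -!setI_eq0 finset.setIUl finset.setU_eq0.
have [dST|dST] := boolP [disjoint S & T]; have [dTW|dTW] := boolP [disjoint T & W];
  rewrite ?(ext_wedgeZl, ext_wedgeZr, ext_wedge0l, ext_wedge0r) ?ext_wedge_base //;
  rewrite ?dU ?dV ?dST ?(negPf dST) ?(negPf dTW) ?dTW ?andbF ?andbT ?scaler0 //=.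
case: ifP => dSW; rewrite ?scaler0 // !scalerA finset.setUA -!exprD.
by rewrite inversionsUl // inversionsUr // addnC addnA.
Qed.

Lemma ext_wedge1l a : ext_wedge ext_one a = a.
Proof.
apply/ffunP => U; rewrite !ffunE (bigD1 finset.set0) ?finset.sub0set //= big1 ?addr0.
  rewrite ffunE eqxx mulr1 finset.setD0 inversionsE big_set0 expr0 mul1r //.
by move=> S /andP[_ SU]; rewrite ffunE (negPf SU) mulr0 mul0r.
Qed.

Lemma ext_wedge1r a : ext_wedge a ext_one = a.
Proof.
apply/ffunP => U; rewrite !ffunE (bigD1 U) //= big1 ?addr0.
  rewrite ffunE finset.setDv eqxx mulr1 inversionsE big1 ?expr0 ?mul1r // => x _.
  by rewrite big_set0.
move=> S /andP[SU nSU]; rewrite ffunE finset.setD_eq0; case: (boolP (U \subset S)) => US;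
  last by rewrite mulr0.
by rewrite finset.eqEsubset SU US in nSU.
Qed.

HB.instance Definition _ :=
  Monoid.isLaw.Build (extalg R m) ext_one ext_wedge ext_wedgeA ext_wedge1l ext_wedge1r.

Lemma ext_base_ind (P : extalg R m -> Prop) :
  P 0 -> (forall a b, P a -> P b -> P (a + b)) -> (forall k a, P a -> P (k *: a)) ->
  (forall S, P (ext_base S)) -> forall a, P a.
Proof.
move=> P0 PD PZ PB a; rewrite [a]ext_expand.
by apply: (big_ind P) => // S _; apply: PZ.
Qed.

Lemma ext_dx_base i : ext_dx i = ext_base [set i].
Proof. by []. Qed.

Lemma ext_dx_wedge_base i S : i \notin S ->
  ext_wedge (ext_dx i) (ext_base S) = (-1) ^+ inversions [set i] S *: ext_base (i |: S).
Proof. by move=> iS; rewrite ext_dx_base ext_wedge_base disjoints1 iS. Qed.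

Lemma ext_signrK k (x : extalg R m) : (-1) ^+ k *: ((-1) ^+ k *: x) = x.
Proof. by rewrite scalerA -exprD addnn -mul2n exprM sqrrN !expr1n scale1r. Qed.

Lemma ext_ind (P : extalg R m -> Prop) :
  P 0 -> (forall a b, P a -> P b -> P (a + b)) -> (forall k a, P a -> P (k *: a)) ->
  P ext_one -> (forall i a, P a -> P (ext_wedge (ext_dx i) a)) -> forall a, P a.
Proof.
move=> P0 PD PZ P1 Pdx; apply: ext_base_ind => // S.
move: {2}#|S| (erefl #|S|) => k; elim: k => [|k IH] in S *.
  by move=> /eqP; rewrite cards_eq0 => /eqP ->.
move=> cS; have [i iS] : exists i, i \in S by apply/set0Pn; rewrite -cards_eq0 cS.
have := @ext_dx_wedge_base i (S :\ i); rewrite finset.setD11 finset.setD1K // => /(_ isT).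
move=> /(congr1 (fun x => (-1) ^+ inversions [set i] (S :\ i) *: x));
  rewrite ext_signrK => <-.
by apply/PZ/Pdx/IH; move: cS; rewrite (cardsD1 i) iS => -[].
Qed.

Lemma ext_dx_wedgeE i a U : ext_wedge (ext_dx i) a U =
  if i \in U then (-1) ^+ inversions [set i] (U :\ i) * a (U :\ i) else 0.
Proof.
rewrite !ffunE; case: ifP => iU.
  rewrite (bigD1 [set i]) ?finset.sub1set //= big1 ?addr0 => [|S /andP[_ SU]].
    by rewrite ffunE eqxx mulr1.
  by rewrite ffunE (negPf SU) mulr0 mul0r.
rewrite big1 // => S SU; rewrite ffunE; case: eqP => [SE|]; last by rewrite mulr0 mul0r.
by move: SU; rewrite SE finset.sub1set iU.
Qed.

Definition ext_inner i a : extalg R m :=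
  [ffun U : {set 'I_m} =>
     if i \in U then 0 else (-1) ^+ inversions [set i] U * a (i |: U)].

Lemma ext_inner_linear i : linear (ext_inner i).
Proof.
move=> k a b; apply/ffunP => U; rewrite !ffunE; case: ifP => _;
  rewrite ?scaler0 ?addr0 //.
by rewrite /GRing.scale /=; ring.
Qed.
HB.instance Definition _ i :=
  GRing.isLinear.Build R (extalg R m) (extalg R m) _ (ext_inner i) (ext_inner_linear i).

Lemma inversions1E i U : inversions [set i] U = (\sum_(j in U) (j < i)%N)%N.
Proof. by rewrite inversionsE big_set1. Qed.

Lemma ext_inner_dx i j a : ext_inner i (ext_wedge (ext_dx j) a) =
  (i == j)%:R *: a - ext_wedge (ext_dx j) (ext_inner i a).
Proof.
apply/ffunP => U; rewrite [LHS]ffunE ext_dx_wedgeE.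
rewrite ffunE [((i == j)%:R *: a) U]ffunE [(- ext_wedge _ _) U]ffunE ext_dx_wedgeE
  [ext_inner i a _]ffunE.
have [->{i}|ij] := eqVneq i j.
  rewrite finset.setU11 finset.setD11 scale1r; case: ifP => jU.
    rewrite finset.setD1K // mulrA -exprD addnn -mul2n exprM sqrrN !expr1n mul1r subrr //.
  by rewrite oppr0 addr0 finset.setU1K ?jU //
    mulrA -exprD addnn -mul2n exprM sqrrN !expr1n mul1r.
rewrite scale0r add0r !inE ij (eq_sym j) (negPf ij) /=; case: ifP => iU; rewrite ?mulr0.
  by case: ifP; rewrite ?oppr0.
case: ifP => jU; rewrite ?mulr0 ?oppr0 //.
have -> : ((i |: U) :\ j) = (i |: (U :\ j)).
  by apply/finset.setP => x; rewrite !inE; have [->|] := eqVneq x j;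
    rewrite // eq_sym (negPf ij).
rewrite !mulrA -!exprD -mulNr; congr (_ * _).
rewrite !inversions1E big_setU1 ?inE ?iU ?andbF //= (big_setD1 j) //=.
rewrite -[RHS]mulN1r -exprS -[LHS]signr_odd -[RHS]signr_odd;
  congr ((-1) ^+ nat_of_bool _).
rewrite /= !oddD.
set u := (\sum_(x in U :\ j) (x < i)%N)%N; set v := (\sum_(x in U :\ j) (x < j)%N)%N.
by move: ij; rewrite -val_eqE /=; case: (odd u); case: (odd v); case: ltngtP.
Qed.

Lemma ext_inner1 i : ext_inner i ext_one = 0.
Proof.
apply/ffunP => U; rewrite !ffunE; case: ifP => // _.
case: eqP => [iU0|]; last by rewrite mulr0.
by have := finset.setU11 i U; rewrite iU0 inE.
Qed.

Lemma ext_dxC i j :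
  ext_wedge (ext_dx i) (ext_dx j) = - ext_wedge (ext_dx j) (ext_dx i) :> extalg R m.
Proof.
rewrite !ext_dx_base !ext_wedge_base !disjoints1 !inE (eq_sym j).
have [->|ij] := eqVneq i j; rewrite /= ?oppr0 //.
rewrite finset.setUC -scaleNr !inversions1E !big_set1; congr (_ *: _).
by move: ij; rewrite -val_eqE /=; case: ltngtP; rewrite ?expr1 ?expr0 ?opprK.
Qed.

Definition ext_grade a : extalg R m := [ffun S : {set 'I_m} => (-1) ^+ #|S| * a S].

Lemma ext_grade_linear : linear ext_grade.
Proof. by move=> k a b; apply/ffunP => U; rewrite !ffunE /GRing.scale /=; ring. Qed.
HB.instance Definition _ :=
  GRing.isLinear.Build R (extalg R m) (extalg R m) _ ext_grade ext_grade_linear.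

Lemma ext_grade1 : ext_grade ext_one = ext_one.
Proof.
apply/ffunP => U; rewrite !ffunE; have [->|] := eqVneq U finset.set0; rewrite ?mulr0 //.
by rewrite cards0 expr0 mul1r.
Qed.

Lemma ext_grade_dx i a : ext_grade (ext_wedge (ext_dx i) a) =
  - ext_wedge (ext_dx i) (ext_grade a).
Proof.
apply/ffunP => U; rewrite [LHS]ffunE [RHS]ffunE !ext_dx_wedgeE; case: ifP => iU;
  rewrite ?mulr0 ?oppr0 //.
by rewrite [ext_grade a _]ffunE (cardsD1 i U) iU add1n exprS; ring.
Qed.

Lemma ext_grade_homogeneous k a : ext_homogeneous k a -> ext_grade a = (-1) ^+ k *: a.
Proof.
move=> ha; apply/ffunP => U; rewrite !ffunE; have [<- //|/ha ->] := eqVneq #|U| k.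
by rewrite scaler0 mulr0.
Qed.

Lemma ext_wedge_dx a i : ext_wedge a (ext_dx i) = ext_wedge (ext_dx i) (ext_grade a).
Proof.
elim/ext_ind: a => [|a b IHa IHb|k a IH||j a IH].
- by rewrite linear0 ext_wedge0l ext_wedge0r.
- by rewrite linearD ext_wedgeDl ext_wedgeDr IHa IHb.
- by rewrite linearZ /= ext_wedgeZl ext_wedgeZr IH.
- by rewrite ext_grade1 ext_wedge1l ext_wedge1r.
- by rewrite -ext_wedgeA IH ext_grade_dx !ext_wedgeA ext_dxC ext_wedgeNl -!ext_wedgeA
  ext_wedgeNr.
Qed.

Lemma ext_inner_wedge i a b : ext_inner i (ext_wedge a b) =
  ext_wedge (ext_inner i a) b + ext_wedge (ext_grade a) (ext_inner i b).
Proof.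
elim/ext_ind: a => [|a c IHa IHc|k a IH||j a IH].
- by rewrite !linear0 !ext_wedge0l linear0 addr0.
- by rewrite !linearD /= !ext_wedgeDl linearD /= IHa IHc addrACA.
- by rewrite !linearZ /= !ext_wedgeZl linearZ /= IH scalerDr.
- by rewrite ext_grade1 ext_inner1 !ext_wedge1l ext_wedge0l add0r.
- rewrite -ext_wedgeA !ext_inner_dx IH ext_grade_dx ext_wedgeDl !ext_wedgeNl ext_wedgeZl
  ext_wedgeDr.
  by rewrite !ext_wedgeA opprD addrA.
Qed.

Lemma ext_euler k a : ext_homogeneous k a ->
  \sum_i ext_wedge (ext_dx i) (ext_inner i a) = k%:R *: a.
Proof.
move=> ha; apply/ffunP => U; rewrite sum_ffunE ffunE.
rewrite (eq_bigr (fun i => if i \in U then a U else 0)) => [|i _]; last first.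
  rewrite ext_dx_wedgeE; case: ifP => // iU; rewrite ffunE finset.setD11 finset.setD1K //.
  by rewrite mulrA -exprD addnn -mul2n exprM sqrrN !expr1n mul1r.
rewrite -big_mkcond /= sumr_const; have [<-|/ha ->] := eqVneq #|U| k;
  first by rewrite -[LHS]mulr_natl.
by rewrite mul0rn scaler0.
Qed.

Lemma ext_wedge_homogeneous (k l : nat) a b : ext_homogeneous k a -> ext_homogeneous l b
  ->
  ext_homogeneous (k + l) (ext_wedge a b).
Proof.
move=> ha hb U nU; rewrite ffunE big1 // => S SU.
have [Sk|/ha ->] := eqVneq #|S| k; last by rewrite mulr0 mul0r.
rewrite hb ?mulr0 //; apply: contraNneq nU => <-; rewrite -Sk cardsD (finset.setIidPr SU).
by rewrite subnKC // subset_leq_card.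
Qed.

Lemma ext_wedgeC (k l : nat) a b : ext_homogeneous k a -> ext_homogeneous l b ->
  ext_wedge b a = (-1) ^+ (k * l) *: ext_wedge a b.
Proof.
move=> ha hb; rewrite [b]ext_expand !(ext_wedge_suml, ext_wedge_sumr) scaler_sumr;
  apply: eq_bigr => T _.
rewrite !(ext_wedgeZl, ext_wedgeZr); have [Tl|/hb ->] := eqVneq #|T| l;
  last by rewrite !scale0r scaler0.
rewrite scalerA mulrC -scalerA; congr (_ *: _).
rewrite [a]ext_expand !(ext_wedge_suml, ext_wedge_sumr) scaler_sumr;
  apply: eq_bigr => S _.
rewrite !(ext_wedgeZl, ext_wedgeZr); have [Sk|/ha ->] := eqVneq #|S| k;
  last by rewrite !scale0r scaler0.
rewrite scalerA mulrC -scalerA; congr (_ *: _).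
rewrite !ext_wedge_base disjoint_sym finset.setUC; case: ifP => dST;
  last by rewrite scaler0.
rewrite scalerA -Tl -Sk -(inversions_swap dST) exprD mulrAC -expr2 -exprM mulnC exprM
  sqrrN.
by rewrite !expr1n mul1r.
Qed.

End ExteriorAlgebraTheory.

(** * Pullbacks and contraction with a bivector *)

Section Pullback.
Local Open Scope bool_scope.
Local Open Scope set_scope.
Local Open Scope ring_scope.
Context {R : realType} {m : nat}.
Implicit Types (a b : extalg R m) (S : {set 'I_m}) (i j l : 'I_m) (J : 'M[R]_m).

Lemma ext_pullback_linear J : linear (ext_pullback J).
Proof.
move=> k a b; rewrite /ext_pullback scaler_sumr -big_split /=; apply: eq_bigr => S _.
by rewrite !ffunE scalerDl scalerA.
Qed.
HB.instance Definition _ J :=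
  GRing.isLinear.Build R (extalg R m) (extalg R m) _ (ext_pullback J)
    (ext_pullback_linear J).

Lemma ext_pullback_base J S : ext_pullback J (ext_base S) =
  \big[ext_wedge/ext_one]_(i <- enum S) \sum_(l < m) J i l *: ext_dx l.
Proof.
rewrite /ext_pullback [LHS](bigD1 S) //= [X in _ + X]big1 ?addr0 => [|T TS].
  by rewrite ffunE eqxx scale1r.
by rewrite ffunE (negPf TS) scale0r.
Qed.

Lemma ext_pullback1 J : ext_pullback J ext_one = ext_one.
Proof. by rewrite -[ext_one]/(ext_base finset.set0) ext_pullback_base enum_set0 big_nil.
Qed.

Lemma ext_pullback_dx J i : ext_pullback J (ext_dx i) = \sum_l J i l *: ext_dx l.
Proof. by rewrite ext_dx_base ext_pullback_base enum_set1 big_seq1. Qed.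

Lemma enum_setU1 i S :
  enum (i |: S) = [seq x : 'I_m <- enum S | (x < i)%N] ++ i :: [seq x : 'I_m <- enum S |
    (i < x)%N].
Proof.
have ltr : transitive (fun x y : 'I_m => (x < y)%N) by move=> y x z; apply: ltn_trans.
have sI T : sorted (fun x y : 'I_m => (x < y)%N) (enum T).
  apply: (sorted_filter ltr); rewrite -enumT.
  by have := iota_ltn_sorted 0 m; rewrite -val_enum_ord sorted_map.
apply: (irr_sorted_eq ltr) => //; first by move=> x; rewrite ltnn.
  have sF (p : pred 'I_m) := sorted_filter ltr p (sI _ S).
  rewrite sorted_pairwise // pairwise_cat /= -!sorted_pairwise // !sF !andbT.
  apply/andP; split; last by apply/allP => x; rewrite mem_filter => /andP[].
  apply/allrelP => x y; rewrite mem_filter inE => /andP[xi _] /orP[/eqP->//|].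
  by rewrite mem_filter => /andP[iy _]; apply: ltn_trans iy.
move=> x; rewrite mem_cat in_cons !mem_filter -!enumT !mem_enum !andbT.
rewrite -[mem (i |: S) x]/(x \in i |: S) -[mem S x]/(x \in S) in_setU1.
by rewrite -val_eqE /=; case: ltngtP; rewrite ?orbT ?orbF.
Qed.

Lemma enum_split i S : i \notin S ->
  enum S = [seq x : 'I_m <- enum S | (x < i)%N] ++ [seq x : 'I_m <- enum S | (i < x)%N].
Proof.
move=> iS; have E : enum S = [seq x <- enum (i |: S) | x != i].
  rewrite -filter_predI; apply: eq_filter => x /=.
  by rewrite in_setU1; have [->|] := eqVneq x i; rewrite ?(negPf iS).
rewrite {1}E enum_setU1 filter_cat /= eqxx /=; congr (_ ++ _);
  apply/all_filterP/allP => x;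
  rewrite mem_filter -val_eqE /= => /andP[xi _]; by move: xi; case: ltngtP.
Qed.

Lemma ext_oneform_sq (f : 'I_m -> R) :
  ext_wedge (\sum_l f l *: ext_dx l) (\sum_l f l *: ext_dx l) = 0 :> extalg R m.
Proof.
have E (u v : 'I_m -> R) : ext_wedge (\sum_l u l *: ext_dx l) (\sum_l v l *: ext_dx l) =
    - ext_wedge (\sum_l v l *: ext_dx l) (\sum_l u l *: ext_dx l) :> extalg R m.
  rewrite !ext_wedge_suml -sumrN; under eq_bigr do rewrite ext_wedge_sumr.
  rewrite exchange_big /=; apply: eq_bigr => i _; rewrite ext_wedge_sumr -sumrN;
    apply: eq_bigr => j _.
  by rewrite !(ext_wedgeZl, ext_wedgeZr) ext_dxC !scalerN !scalerA mulrC.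
have := E f f; set x := ext_wedge _ _ => /eqP; rewrite -addr_eq0 -mulr2n => /eqP x2.
by apply: (scalerI (a := 2%:R)); rewrite ?pnatr_eq0 // scaler0 scaler_nat.
Qed.

Lemma ext_oneformC (f g : 'I_m -> R) :
  ext_wedge (\sum_l f l *: ext_dx l) (\sum_l g l *: ext_dx l) =
  - ext_wedge (\sum_l g l *: ext_dx l) (\sum_l f l *: ext_dx l) :> extalg R m.
Proof.
have := ext_oneform_sq (fun l => f l + g l).
under eq_bigr do rewrite scalerDl.
rewrite big_split /= ext_wedgeDl !ext_wedgeDr !ext_oneform_sq add0r addr0.
by move=> /eqP; rewrite addr_eq0 => /eqP.
Qed.

Lemma ext_pullback_dx_wedge J i a :
  ext_pullback J (ext_wedge (ext_dx i) a) =
  ext_wedge (\sum_l J i l *: ext_dx l) (ext_pullback J a).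
Proof.
pose v j : extalg R m := \sum_l J j l *: ext_dx l.
have vprod s : ext_wedge (v i) (\big[ext_wedge/ext_one]_(x <- s) v x) =
    (-1) ^+ size s *: ext_wedge (\big[ext_wedge/ext_one]_(x <- s) v x) (v i).
  elim: s => [|x s IH]; first by rewrite big_nil scale1r ext_wedge1l ext_wedge1r.
  rewrite big_cons ext_wedgeA [ext_wedge (v i) _]ext_oneformC ext_wedgeNl -ext_wedgeA IH.
  by rewrite ext_wedgeZr -scaleNr ext_wedgeA exprS mulN1r.
elim/(@ext_base_ind R m): a => [|a b IHa IHb|k a IH|S].
- by rewrite !linear0.
- by rewrite ext_wedgeDr !linearD /= IHa IHb.
- by rewrite ext_wedgeZr !linearZ /= IH.
rewrite -/(v i) [in RHS]ext_pullback_base.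
have [iS|iS] := boolP (i \in S).
  rewrite ext_dx_base ext_wedge_base disjoints1 iS linear0.
  have <- : i |: S = S by apply/finset.setUidPr; rewrite finset.sub1set.
  rewrite enum_setU1 big_cat big_cons /= ext_wedgeA vprod ext_wedgeZl -ext_wedgeA [X in
    ext_wedge _ X]ext_wedgeA.
  by rewrite ext_oneform_sq ext_wedge0l ext_wedge0r scaler0.
rewrite ext_dx_wedge_base // linearZ /= ext_pullback_base enum_setU1 {3}(enum_split iS).
rewrite !big_cat big_cons /= [RHS]ext_wedgeA [in RHS]vprod ext_wedgeZl -ext_wedgeA;
  congr ((-1) ^+ _ *: _).
rewrite inversions1E size_filter -sum1_count [RHS]big_mkcond big_enum /=.
by apply: eq_bigr => x _; case: (_ < _)%N.
Qed.

Lemma ext_pullback_wedge J a b :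
  ext_pullback J (ext_wedge a b) = ext_wedge (ext_pullback J a) (ext_pullback J b).
Proof.
elim/(@ext_ind R m): a => [|a c IHa IHc|k a IH||i a IH].
- by rewrite ext_wedge0l !linear0 ext_wedge0l.
- by rewrite ext_wedgeDl !linearD /= IHa IHc ext_wedgeDl.
- by rewrite ext_wedgeZl !linearZ /= IH ext_wedgeZl.
- by rewrite ext_pullback1 !ext_wedge1l.
- by rewrite -ext_wedgeA !ext_pullback_dx_wedge IH ext_wedgeA.
Qed.

Lemma ext_inner_pullback J l a :
  ext_inner l (ext_pullback J a) = \sum_i J i l *: ext_pullback J (ext_inner i a).
Proof.
elim/(@ext_ind R m): a => [|a c IHa IHc|k a IH||j a IH].
- by rewrite !linear0 big1 // => i _; rewrite !linear0.
- by rewrite !linearD /= IHa IHc -big_split; apply: eq_bigr => i _; rewrite !linearD.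
- rewrite !linearZ /= IH scaler_sumr; apply: eq_bigr => i _.
  by rewrite !linearZ /= !scalerA mulrC.
- by rewrite ext_pullback1 ext_inner1 big1 // => i _; rewrite ext_inner1 !linear0.
rewrite ext_pullback_dx_wedge.
have E : ext_inner l (ext_wedge (\sum_l J j l *: ext_dx l) (ext_pullback J a)) =
    J j l *: ext_pullback J a
    - ext_wedge (\sum_l J j l *: ext_dx l) (ext_inner l (ext_pullback J a)).
  rewrite !ext_wedge_suml linear_sum /=.
  under eq_bigr do rewrite ext_wedgeZl linearZ /= ext_inner_dx scalerBr.
  rewrite big_split /= -sumrN; congr (_ + _); last first.
    by apply: eq_bigr => x _; rewrite ext_wedgeZl.
  rewrite (bigD1 l) //= eqxx scale1r big1 ?addr0 // => x xl.
  by rewrite eq_sym (negPf xl) scale0r scaler0.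
rewrite E IH; under [RHS]eq_bigr do rewrite ext_inner_dx linearB linearZ /= scalerBr
  ext_pullback_dx_wedge.
rewrite big_split /= sumrN; congr (_ - _).
  rewrite (bigD1 j) //= eqxx scale1r big1 ?addr0 // => x xl.
  by rewrite (negPf xl) scale0r scaler0.
by rewrite ext_wedge_sumr; apply: eq_bigr => x _; rewrite ext_wedgeZr.
Qed.

Lemma ext_inner_gram a i : ext_homogeneous 2 a ->
  ext_inner i a = \sum_l ext_gram a i l *: ext_dx l.
Proof.
move=> ha; apply/ffunP => U; rewrite sum_ffunE.
rewrite (eq_bigr (fun l => ext_gram a i l * (U == [set l])%:R)) => [|l _];
  last by rewrite !ffunE.
have [U1|nU1] := boolP (#|U| == 1)%N; last first.
  rewrite big1 => [|l _]; last first.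
    case: eqP => [UE|_]; last by rewrite mulr0.
    by rewrite UE cards1 in nU1.
  rewrite ffunE; case: ifP => // iU; rewrite ha ?mulr0 // cardsU1 iU add1n eqSS.
  exact: nU1.
have /cards1P[l ->] := U1.
rewrite (bigD1 l) //= eqxx big1 ?addr0 => [|x xl]; last first.
  by rewrite (inj_eq finset.set1_inj) eq_sym (negPf xl) mulr0.
rewrite mulr1 ffunE inE inversions1E big_set1 mxE -val_eqE /=.
by case: ltngtP => // _; rewrite ?expr1 ?mulN1r ?expr0 ?mul1r.
Qed.

Lemma ext_oneform_inj (f g : 'I_m -> R) :
  \sum_l f l *: ext_dx l = \sum_l g l *: ext_dx l :> extalg R m -> f =1 g.
Proof.
move=> fg l; have := congr1 (fun a : extalg R m => a [set l]) fg; rewrite !sum_ffunE.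
have E (h : 'I_m -> R) : \sum_x (h x *: ext_dx x : extalg R m) [set l] = h l.
  rewrite (bigD1 l) //= big1 ?addr0 => [|x xl]; rewrite !ffunE /GRing.scale /=.
    by rewrite eqxx mulr1.
  by rewrite (inj_eq finset.set1_inj) eq_sym (negPf xl) mulr0.
by rewrite !E.
Qed.

Lemma ext_oneform_sum I (r : seq I) (c : I -> R) (f : I -> 'I_m -> R) :
  \sum_(x <- r) c x *: (\sum_l f x l *: ext_dx l) =
  \sum_l (\sum_(x <- r) c x * f x l) *: ext_dx l :> extalg R m.
Proof.
rewrite (eq_bigr (fun x => \sum_l (c x * f x l) *: ext_dx l)) => [|x _]; last first.
  by rewrite scaler_sumr; apply: eq_bigr => l _; rewrite scalerA.
by rewrite exchange_big; apply: eq_bigr => l _; rewrite scaler_suml.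
Qed.

Lemma ext_pullback_oneform J (f : 'I_m -> R) :
  ext_pullback J (\sum_l f l *: ext_dx l) = \sum_x (\sum_l f l * J l x) *: ext_dx x.
Proof.
rewrite linear_sum -ext_oneform_sum; apply: eq_bigr => l _.
by rewrite linearZ /= ext_pullback_dx.
Qed.

Lemma ext_gram_pullback J a : ext_homogeneous 2 a -> ext_homogeneous 2 (ext_pullback J a)
  ->
  ext_gram (ext_pullback J a) = J^T *m ext_gram a *m J.
Proof.
move=> ha hJa; apply/matrixP => l; apply: ext_oneform_inj.
rewrite -ext_inner_gram // ext_inner_pullback.
rewrite (eq_bigr (fun i => J i l *:
  \sum_y (\sum_x ext_gram a i x * J x y) *: ext_dx y)) => [|i _]; last first.
  by rewrite ext_inner_gram // ext_pullback_oneform.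
rewrite ext_oneform_sum; apply: eq_bigr => y _; congr (_ *: _).
rewrite !mxE; under [RHS]eq_bigr do rewrite mxE big_distrl /=.
rewrite [RHS]exchange_big /=; apply: eq_bigr => i _; rewrite big_distrr /=;
  apply: eq_bigr => x _.
by rewrite [J^T _ _]mxE mulrA.
Qed.

Definition ext_lam (P : 'M[R]_m) a : extalg R m :=
  2^-1 *: \sum_i \sum_l P i l *: ext_inner i (ext_inner l a).

Lemma ext_lam_linear P : linear (ext_lam P).
Proof.
move=> k a b; rewrite /ext_lam !scaler_sumr -big_split /=; apply: eq_bigr => i _.
rewrite !scaler_sumr -big_split /=; apply: eq_bigr => l _.
have -> : ext_inner i (ext_inner l (k *: a + b)) =
  k *: ext_inner i (ext_inner l a) + ext_inner i (ext_inner l b) by rewrite !linearP.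
by rewrite !scalerDr !scalerA; congr (_ *: _ + _ ); ring.
Qed.
HB.instance Definition _ P :=
  GRing.isLinear.Build R (extalg R m) (extalg R m) _ (ext_lam P) (ext_lam_linear P).

Lemma ext_lam_pullback J P P' a : J *m P *m J^T = P' ->
  ext_lam P (ext_pullback J a) = ext_pullback J (ext_lam P' a).
Proof.
move=> <-; rewrite /ext_lam linearZ /=; congr (_ *: _).
rewrite linear_sum /=.
have E i l : P i l *: ext_inner i (ext_inner l (ext_pullback J a)) =
    \sum_x \sum_y (J x i * P i l * J y l) *: ext_pullback J (ext_inner x (ext_inner y a)).
  rewrite ext_inner_pullback linear_sum /= exchange_big /= scaler_sumr;
    apply: eq_bigr => y _.
  rewrite linearZ /= ext_inner_pullback !scaler_sumr; apply: eq_bigr => x _.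
  by rewrite !scalerA; congr (_ *: _); ring.
under eq_bigr do under eq_bigr do rewrite E.
under eq_bigr do rewrite exchange_big /=.
rewrite exchange_big /=; apply: eq_bigr => x _; rewrite linear_sum /=.
under eq_bigr do rewrite exchange_big /=.
rewrite exchange_big /=; apply: eq_bigr => y _.
rewrite linearZ /= mxE scaler_suml exchange_big /=; apply: eq_bigr => l _.
by rewrite mxE big_distrl /= scaler_suml; apply: eq_bigr => i _; rewrite mxE.
Qed.

Lemma ext_gram_antisym a : (ext_gram a)^T = - ext_gram a.
Proof.
apply/matrixP => i l; rewrite !mxE; case: ltngtP => _; rewrite ?oppr0 ?opprK //.
  by rewrite finset.setUC.
by rewrite finset.setUC.
Qed.

Lemma ext_grade_inner i a : ext_grade (ext_inner i a) = - ext_inner i (ext_grade a).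
Proof.
elim/(@ext_ind R m): a => [|a c IHa IHc|k a IH||j a IH].
- by rewrite !linear0.
- by rewrite !linearD /= IHa IHc.
- by rewrite !linearZ /= IH scalerN.
- by rewrite ext_grade1 ext_inner1 !linear0.
- rewrite ext_inner_dx linearB linearZ /= !ext_grade_dx IH (linearN (ext_inner i)) /=
  ext_inner_dx.
  by rewrite opprK ext_wedgeNr opprK.
Qed.

Lemma ext_lam_wedge (w a : extalg R m) k : ext_homogeneous 2 w -> ext_homogeneous k a ->
  ext_gram w \in unitmx ->
  ext_lam (invmx (ext_gram w)) (ext_wedge w a) =
  ext_wedge w (ext_lam (invmx (ext_gram w)) a) + (2^-1 * m%:R - k%:R) *: a.
Proof.
move=> hw ha uG; set G := ext_gram w; set P := invmx G.
have PG : P *m G = 1%:M by rewrite mulVmx.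
have GP : G *m P = 1%:M by rewrite mulmxV.
have PT : P^T = - P.
  rewrite -[LHS]mulmx1 -GP mulmxA -[G]opprK -ext_gram_antisym -/G mulmxN -trmx_mul GP.
  by rewrite trmx1 mulNmx mul1mx.
pose u i : extalg R m := \sum_l G i l *: ext_dx l.
have gw : ext_grade w = w by rewrite (ext_grade_homogeneous hw) sqrrN expr1n scale1r.
have ii i l : ext_inner i (ext_inner l (ext_wedge w a)) =
    G l i *: a + - ext_wedge (u l) (ext_inner i a) + ext_wedge (u i) (ext_inner l a)
    + ext_wedge w (ext_inner i (ext_inner l a)).
  rewrite ext_inner_wedge linearD /= !ext_inner_wedge gw ext_grade_inner gw -!addrA.
  rewrite !(ext_inner_gram _ hw) -/(u l) -/(u i) -/G ext_wedgeNl; congr (_ + _).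
  rewrite linear_sum /= (bigD1 i) //= big1 ?addr0 => [|x xi].
    rewrite linearZ /= -[ext_dx i]ext_wedge1r ext_inner_dx eqxx scale1r ext_inner1
      ext_wedge0r subr0.
    by rewrite ext_wedgeZl ext_wedge1l.
  rewrite linearZ /= -[ext_dx x]ext_wedge1r ext_inner_dx eq_sym (negPf xi) scale0r
    ext_inner1 ext_wedge0r subr0.
  by rewrite scaler0.
rewrite /ext_lam ext_wedgeZr.
under eq_bigr do under eq_bigr do rewrite ii !scalerDr.
under eq_bigr do rewrite !big_split /=.
rewrite !big_split /= !scalerDr addrC; congr (_ + _).
  by rewrite ext_wedge_sumr; congr (_ *: _); apply: eq_bigr => i _;
    rewrite ext_wedge_sumr;
    apply: eq_bigr => l _; rewrite ext_wedgeZr.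
have t1 : \sum_i \sum_l P i l *: (G l i *: a) = m%:R *: a.
  rewrite -(mxtrace1 R m) -PG /mxtrace scaler_suml; apply: eq_bigr => i _.
  by rewrite mxE scaler_suml; apply: eq_bigr => l _; rewrite scalerA.
have t3 : \sum_i \sum_l P i l *: ext_wedge (u i) (ext_inner l a) = - (k%:R *: a).
  rewrite -(ext_euler ha) -sumrN exchange_big /=; apply: eq_bigr => l _.
  under eq_bigr do rewrite -ext_wedgeZl.
  rewrite -ext_wedge_suml -ext_wedgeNl; congr (ext_wedge _ _).
  have E x : \sum_(i < m) P i l * G i x = - (l == x)%:R.
    have := congr1 (fun A : 'M[R]_m => A l x) PG; rewrite mxE [in RHS]mxE => <-.
    rewrite -sumrN; apply: eq_bigr => i _.
    by have := congr1 (fun A : 'M[R]_m => A l i) PT;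
      rewrite [P^T _ _]mxE [(- P) _ _]mxE => ->; rewrite mulNr.
  rewrite ext_oneform_sum (bigD1 l) //= [X in _ + X]big1 ?addr0 => [|x xl]; rewrite E.
    by rewrite eqxx scaleN1r.
  by rewrite eq_sym (negPf xl) oppr0 scale0r.
have t2 : \sum_i \sum_l P i l *: - ext_wedge (u l) (ext_inner i a) = - (k%:R *: a).
  rewrite -t3 exchange_big /=; apply: eq_bigr => i _; apply: eq_bigr => l _.
  by have := congr1 (fun A : 'M[R]_m => A i l) PT;
    rewrite [P^T _ _]mxE [(- P) _ _]mxE => ->; rewrite scaleNr scalerN opprK.
rewrite t1 t2 t3 -!scaleNr !scalerA -!scalerDl; congr (_ *: _).
by field.
Qed.

Lemma ext_inner_homogeneous k i a : ext_homogeneous k.+1 a -> ext_homogeneous k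
  (ext_inner i a).
Proof.
move=> ha U nU; rewrite ffunE; case: ifP => // iU; rewrite ha ?mulr0 //.
by rewrite cardsU1 iU add1n eqSS.
Qed.

Lemma ext_inner_homogeneous0 i a : ext_homogeneous 0 a -> ext_inner i a = 0.
Proof.
move=> ha; apply/ffunP => U; rewrite !ffunE; case: ifP => // iU; rewrite ha ?mulr0 //.
by rewrite cardsU1 iU.
Qed.

Lemma ext_lam_homogeneous k P a : ext_homogeneous k.+2 a -> ext_homogeneous k (ext_lam P
  a).
Proof.
move=> ha U nU; rewrite ffunE sum_ffunE big1 ?scaler0 // => i _;
  rewrite sum_ffunE big1 // => l _.
rewrite ffunE (ext_inner_homogeneous (k := k)) ?scaler0 //.
exact: ext_inner_homogeneous.
Qed.

Lemma ext_lam_homogeneous0 k P a : (k < 2)%N -> ext_homogeneous k a -> ext_lam P a = 0.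
Proof.
move=> k2 ha; rewrite /ext_lam big1 ?scaler0 // => i _; rewrite big1 // => l _.
case: k k2 ha => [|[|//]] _ ha; first by rewrite (ext_inner_homogeneous0 _ ha) linear0
  scaler0.
by rewrite ext_inner_homogeneous0 ?scaler0 //; apply: ext_inner_homogeneous.
Qed.

End Pullback.

(** * Symmetry of second derivatives and smooth functions *)

Section Calculus.
Context {R : realType}.

Lemma near_eq_differentiable (V W : normedModType R) (f g : V -> W) (x : V) :
  (\forall y \near x, f y = g y) -> differentiable f x -> differentiable g x.
Proof.
move=> fg df; pose e := g - f.
have e0 : \forall y \near x, e y = 0.
  by apply: filterS fg => y fgy; rewrite -[LHS]/(g y - f y) fgy subrr.
have eE : e \o shift x = cst (e x) + (0 : V -> W) +o_ 0 id.
  apply/eqaddoP => _/posnumP[eps].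
  have : \forall h \near (0 : V), e (h + x) = 0 by move: e0; rewrite (near_shift 0) subr0.
  apply: filterS => h eh; rewrite !fctE /= eh (nbhs_singleton e0) !addr0 subrr normr0.
  by rewrite mulr_ge0.
have de : differentiable e x.
  have d0 : 'd e x = (0 : V -> W) :> (V -> W) by apply: (@diff_unique _ _ _ _ (\0 :
    {linear V -> W}) ) => //; exact: cst_continuous.
  by apply/diff_locallyP; rewrite d0; split => //; exact: cst_continuous.
have -> : g = f + e by apply/funext => y; rewrite -[RHS]/(f y + (g y - f y)) addrC subrK.
exact: differentiableD.
Qed.

Section Schwarz.
Context {V : normedModType R}.
Implicit Types (f : V -> R) (x u v : V).

Lemma is_derive_line f x u (t : R) : differentiable f (x + t *: u) ->
  is_derive t 1 (fun t => f (x + t *: u)) ('D_u f (x + t *: u)).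
Proof.
move=> df; have : derivable f (x + t *: u) u by exact: diff_derivable.
have E : (fun h : R => h^-1 *: (f (x + (h *: 1 + t) *: u) - f (x + t *: u))) =
    (fun h : R => h^-1 *: (f (h *: u + (x + t *: u)) - f (x + t *: u))).
  by apply/funext => h; rewrite [h *: 1]mulr1 scalerDl addrCA.
move=> dfu; apply: DeriveDef; first by rewrite /derivable /= E.
by rewrite /derive /= E.
Qed.

Lemma second_difference f x u v (eps : R) : 0 < eps ->
  (\forall y \near x, differentiable f y) -> differentiable ('D_u f) x ->
  exists2 delta : R, 0 < delta & forall h : R, 0 < h < delta ->
    `|f (x + h *: u + h *: v) - f (x + h *: u) - (f (x + h *: v) - f x)
      - h ^+ 2 * 'D_v ('D_u f) x| <= eps * h ^+ 2.
Proof.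
move=> eps0 df ddf; pose N : R := 2 * `|u| + `|v| + 1.
have N0 : 0 < N by rewrite /N; have := normr_ge0 u; have := normr_ge0 v; lra.
pose eta : R := eps / N; have eta0 : 0 < eta by exact: divr_gt0.
pose r w : R := 'D_u f (x + w) - 'D_u f x - 'd ('D_u f) x w.
have rE : \forall w \near (0 : V), `|r w| <= eta * `|w|.
  have /eqaddoP/(_ eta eta0) := (diff_locally ddf).
  by apply: filterS => w; rewrite !fctE /= /r opprD addrA [w + x]addrC.
have dfE : \forall w \near (0 : V), differentiable f (x + w).
  by move: df; rewrite (near_shift 0) subr0; apply: filterS => w /=; rewrite addrC.
have /nbhs_ballP[del /= del0 delP] : \forall w \near (0 : V),
  differentiable f (x + w) /\ `|r w| <= eta * `|w|.
  exact: filterI.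
have {}delP w : `|w| < del -> differentiable f (x + w) /\ `|r w| <= eta * `|w|.
  by move=> wd; apply: delP; rewrite -ball_normE /= sub0r normrN.
exists (del / N); first exact: divr_gt0.
move=> h /andP[h0 hd]; have hN : h * N < del by rewrite -ltr_pdivlMr.
have small (t s : R) : 0 <= t <= h -> 0 <= s <= h -> `|t *: u + s *: v| < del.
  move=> /andP[t0 th] /andP[s0 sh]; apply: le_lt_trans hN.
  apply: le_trans (ler_normD _ _) _; rewrite !normrZ !ger0_norm // /N.
  have := ler_wpM2r (normr_ge0 u) th; have := ler_wpM2r (normr_ge0 v) sh.
  have := mulr_ge0 (ltW h0) (normr_ge0 u); nra.
pose g (t : R) : R := f (x + (t *: u + h *: v)) - f (x + (t *: u + 0 *: v)).
pose g' (t : R) : R := 'D_u f (x + (t *: u + h *: v)) - 'D_u f (x + (t *: u + 0 *: v)).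
have dg t : 0 <= t <= h -> is_derive t 1 g (g' t).
  move=> th.
  have aux s : 0 <= s <= h -> is_derive t 1 (fun t =>
    f (x + (t *: u + s *: v))) ('D_u f (x + (t *: u + s *: v))).
    move=> sh; have [dfw _] := delP _ (small _ _ th sh).
    have lineE t' : x + (t' *: u + s *: v) = (x + s *: v) + t' *: u by rewrite addrCA
      addrC.
    rewrite lineE in dfw *; under eq_fun do rewrite lineE.
    exact: is_derive_line.
  apply: is_deriveB; apply: aux; rewrite ?lexx ?(ltW h0) //.
have [c cab E] : exists2 c, c \in `]0, h[%R & g h - g 0 = g' c * (h - 0).
  apply: MVT => // [t|]; first by rewrite in_itv /= => /andP[t0 th]; apply: dg;
    rewrite !ltW.
  apply: derivable_within_continuous => t; rewrite in_itv /= => th.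
  exact: (@ex_derive _ _ _ _ _ _ _ (dg _ th)).
move: cab; rewrite in_itv /= => /andP[c0 ch].
have -> : f (x + h *: u + h *: v) - f (x + h *: u) - (f (x + h *: v) - f x) = g h - g 0.
  by rewrite /g !scale0r !addr0 add0r addrA.
rewrite E subr0 (deriveE v ddf).
have -> : g' c = r (c *: u + h *: v) - r (c *: u + 0 *: v) + h * 'd ('D_u f) x v.
  rewrite /r scale0r addr0 /g' scale0r addr0 linearD !linearZ /=.
  by rewrite /GRing.scale /=; ring.
have [_ r1] := delP _ (small c h ltac:(lra) ltac:(lra)).
have [_ r2] := delP _ (small c 0 ltac:(lra) ltac:(lra)).
set A := r _ in r1 *; set B := r _ in r2 *.
set D := 'd _ _ v.
have -> : (A - B + h * D) * h - h ^+ 2 * D = (A - B) * h by ring.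
rewrite normrM (gtr0_norm h0) expr2 mulrA ler_pM2r //.
have n1 : `|c *: u + h *: v| <= h * (`|u| + `|v|).
  apply: le_trans (ler_normD _ _) _; rewrite !normrZ (gtr0_norm c0) (gtr0_norm h0).
  have := ler_wpM2r (normr_ge0 u) (ltW ch); lra.
have n2 : `|c *: u + 0 *: v| <= h * `|u|.
  by rewrite scale0r addr0 normrZ (gtr0_norm c0); exact: ler_wpM2r (ltW ch).
have n3 : `|A - B| <= eta * (h * (2 * `|u| + `|v|)).
  apply: le_trans (ler_normB _ _) _.
  have := ler_wpM2l (ltW eta0) n1; have := ler_wpM2l (ltW eta0) n2; lra.
apply: le_trans n3 _; have <- : eta * N = eps by rewrite /eta divfK // gt_eqF.
by have := mulr_gt0 eta0 h0; rewrite /N; lra.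
Qed.

Lemma derive_swap f x u v :
  (\forall y \near x, differentiable f y) -> differentiable ('D_u f) x -> differentiable
    ('D_v f) x ->
  'D_v ('D_u f) x = 'D_u ('D_v f) x.
Proof.
move=> df du dv; set a := 'D_v _ _; set b := 'D_u _ _.
apply/eqP; rewrite -subr_eq0 -normr_le0; apply/ler_addgt0Pl => eps eps0; rewrite addr0.
have e2 : 0 < eps / 2 by lra.
have [d1 d10 P1] := second_difference v e2 df du.
have [d2 d20 P2] := second_difference u e2 df dv.
pose h := Num.min d1 d2 / 2.
have m0 : 0 < Num.min d1 d2 by rewrite lt_min d10.
have h0 : 0 < h by rewrite /h; lra.
have hm : h < Num.min d1 d2 by rewrite /h; lra.
have {}P1 := P1 h ltac:(rewrite h0 (lt_le_trans hm) // ge_min lexx //).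
have {}P2 := P2 h ltac:(rewrite h0 (lt_le_trans hm) // ge_min lexx orbT //).
move: P1 P2; rewrite -/a -/b [x + h *: v + _]addrAC.
set X := f (x + _ + _); set Y := f (x + h *: u); set Z := f (x + h *: v) => P1 P2.
have hh : 0 < h ^+ 2 by exact: exprn_gt0.
rewrite -(ler_pM2r hh) -[X in `|_| * X](gtr0_norm hh) -normrM.
have -> : (a - b) * h ^+ 2 = (X - Z - (Y - f x) - h ^+ 2 * b) - (X - Y - (Z - f x) - h ^+
  2 * a) by ring.
apply: le_trans (ler_normB _ _) _; apply: le_trans (lerD P2 P1) _.
by rewrite -mulrDl -splitr.
Qed.

End Schwarz.

Section SmoothOn.
Context {m : nat}.
Implicit Types (U : set 'rV[R]_m) (f g : 'rV[R]_m -> R) (i j l : 'I_m).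

Lemma smooth_on_differentiable U f x : smooth_on U f -> U x -> differentiable f x.
Proof. by move=> sf Ux; exact: (sf [::] x Ux). Qed.

Lemma smooth_on_partial U f i : smooth_on U f -> smooth_on U (partial i f).
Proof. by move=> sf s x Ux; have := sf (rcons s i) x Ux; rewrite foldr_rcons. Qed.

Lemma partial_near f g x i : (\forall y \near x,
  f y = g y) -> partial i f x = partial i g x.
Proof. exact: near_eq_derive. Qed.

Lemma partial_eq_on U f g i x : open U -> (forall y, U y -> f y = g y) -> U x ->
  partial i f x = partial i g x.
Proof.
by move=> oU fg Ux; apply: partial_near; apply: filterS (open_nbhs_nbhs (conj oU Ux)).
Qed.

Lemma smooth_on_coind U (Q : ('rV[R]_m -> R) -> Prop) : open U ->
  (forall f x, Q f -> U x -> differentiable f x) ->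
  (forall f i, Q f -> exists2 g, Q g & forall x, U x -> partial i f x = g x) ->
  forall f, Q f -> smooth_on U f.
Proof.
move=> oU Qd Qp f Qf s.
have [g Qg fg] : exists2 g, Q g & forall x, U x -> foldr partial f s x = g x.
  elim: s => [|i s [g Qg fg]]; first by exists f.
  have [g' Qg' gg'] := Qp g i Qg; exists g' => // x Ux /=.
  by rewrite (partial_eq_on i oU fg Ux) gg'.
move=> x Ux; apply: near_eq_differentiable (Qd _ _ Qg Ux).
by apply: filterS (open_nbhs_nbhs (conj oU Ux)) => y Uy; rewrite fg.
Qed.

Lemma smooth_on_eq U f g : open U -> (forall x, U x -> f x = g x) ->
  smooth_on U f -> smooth_on U g.
Proof.
move=> oU fg sf.
apply: (@smooth_on_coind U (fun g => exists2 f, smooth_on U f & forall x,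
  U x -> f x = g x)) => //.
- move=> {f g fg sf} g x [f sf fg] Ux; apply: near_eq_differentiable (sf [::] _ Ux).
  by apply: filterS (open_nbhs_nbhs (conj oU Ux)) => y Uy; rewrite -fg.
- move=> {f g fg sf} g i [f sf fg]; exists (partial i f).
    by exists (partial i f) => //; exact: smooth_on_partial.
  by move=> x Ux; apply/esym/(partial_eq_on i oU fg Ux).
- by exists f.
Qed.

Lemma partialD f g i x : differentiable f x -> differentiable g x ->
  partial i (fun y => f y + g y) x = partial i f x + partial i g x.
Proof. by move=> df dg; apply: deriveD; exact: diff_derivable. Qed.

Lemma partialM f g i x : differentiable f x -> differentiable g x ->
  partial i (fun y => f y * g y) x = partial i f x * g x + f x * partial i g x.
Proof.
move=> df dg; rewrite /partial (@deriveM _ _ f g); [|exact: diff_derivable..].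
by rewrite addrC [_ *: _]mulrC.
Qed.

Lemma partialV f i x : differentiable f x -> f x != 0 ->
  partial i (fun y => (f y)^-1) x = - ((f x)^-1 * (f x)^-1 * partial i f x).
Proof.
move=> df fx; rewrite /partial (@deriveV _ _ f) //; last exact: diff_derivable.
by rewrite -exprVn expr2 scaleNr.
Qed.

Lemma partial_cst (k : R) i x : partial i (fun=> k) x = 0.
Proof. exact: derive_cst. Qed.

Inductive smooth_gen U : ('rV[R]_m -> R) -> Prop :=
| Gen_smooth f : smooth_on U f -> smooth_gen U f
| Gen_cst k : smooth_gen U (fun=> k)
| Gen_add f g : smooth_gen U f -> smooth_gen U g -> smooth_gen U (fun x => f x + g x)
| Gen_mul f g : smooth_gen U f -> smooth_gen U g -> smooth_gen U (fun x => f x * g x)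
| Gen_inv f : (forall x, U x -> f x != 0) -> smooth_gen U f -> smooth_gen U (fun x =>
  (f x)^-1).

Lemma smooth_gen_on U f : open U -> smooth_gen U f -> smooth_on U f.
Proof.
move=> oU; have gd g x : smooth_gen U g -> U x -> differentiable g x.
  move=> + Ux; elim=> {g} [g|k|g h _ dg _ dh|g h _ dg _ dh|g g0 _ dg].
  - by move/smooth_on_differentiable; apply.
  - exact: differentiable_cst.
  - exact: differentiableD.
  - exact: differentiableM.
  - by apply: differentiableV => //; exact: g0.
apply: smooth_on_coind => // g i.
elim=> {g} [g sg|k|g h sg [g' sg' gg'] sh [h' sh' hh']|g h sg [g' sg' gg'] sh [h' sh'
  hh']|g g0 sg [g' sg' gg']].
- by exists (partial i g) => //; apply/Gen_smooth/smooth_on_partial.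
- by exists (fun=> 0); [exact: Gen_cst|move=> x _; rewrite partial_cst].
- exists (fun x => g' x + h' x); first exact: Gen_add.
  by move=> x Ux; rewrite partialD ?gg' ?hh' //; apply: gd.
- exists (fun x => g' x * h x + g x * h' x); first by apply: Gen_add; apply: Gen_mul.
  by move=> x Ux; rewrite partialM ?gg' ?hh' //; apply: gd.
- exists (fun x => -1 * ((g x)^-1 * (g x)^-1 * g' x)).
    by apply: Gen_mul; [exact: Gen_cst|apply: Gen_mul => //; apply: Gen_mul;
      apply: Gen_inv].
  by move=> x Ux; rewrite partialV ?gg' ?mulN1r //; [exact: gd|exact: g0].
Qed.

Lemma smooth_onD U f g : open U -> smooth_on U f -> smooth_on U g ->
  smooth_on U (fun x => f x + g x).
Proof. by move=> oU sf sg; apply: smooth_gen_on => //; apply: Gen_add; exact: Gen_smooth.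
Qed.

Lemma smooth_onM U f g : open U -> smooth_on U f -> smooth_on U g ->
  smooth_on U (fun x => f x * g x).
Proof. by move=> oU sf sg; apply: smooth_gen_on => //; apply: Gen_mul; exact: Gen_smooth.
Qed.

Lemma smooth_onV U f : open U -> (forall x, U x -> f x != 0) -> smooth_on U f ->
  smooth_on U (fun x => (f x)^-1).
Proof. by move=> oU f0 sf; apply: smooth_gen_on => //; apply: Gen_inv => //;
  exact: Gen_smooth. Qed.

Lemma smooth_on_cst U (k : R) : open U -> smooth_on U (fun=> k).
Proof. by move=> oU; apply: smooth_gen_on => //; exact: Gen_cst. Qed.

Lemma smooth_on_sum U I (r : seq I) (P : pred I) (F : I -> 'rV[R]_m -> R) : open U ->
  (forall z, P z -> smooth_on U (F z)) -> smooth_on U (fun x =>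
    \sum_(z <- r | P z) F z x).
Proof.
move=> oU sF; elim: r => [|z r IH].
  by apply: smooth_on_eq (smooth_on_cst 0 oU) => // x _; rewrite big_nil.
have [Pz|Pz] := boolP (P z); last by apply: smooth_on_eq IH => // x _;
  rewrite big_cons (negPf Pz).
by apply: smooth_on_eq (smooth_onD oU (sF z Pz) IH) => // x _; rewrite big_cons Pz.
Qed.

Lemma smooth_on_prod U I (r : seq I) (P : pred I) (F : I -> 'rV[R]_m -> R) : open U ->
  (forall z, P z -> smooth_on U (F z)) -> smooth_on U (fun x =>
    \prod_(z <- r | P z) F z x).
Proof.
move=> oU sF; elim: r => [|z r IH].
  by apply: smooth_on_eq (smooth_on_cst 1 oU) => // x _; rewrite big_nil.
have [Pz|Pz] := boolP (P z); last by apply: smooth_on_eq IH => // x _;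
  rewrite big_cons (negPf Pz).
by apply: smooth_on_eq (smooth_onM oU (sF z Pz) IH) => // x _; rewrite big_cons Pz.
Qed.

Lemma smooth_on_det U k (A : 'rV[R]_m -> 'M[R]_k) : open U ->
  (forall a b, smooth_on U (fun x => A x a b)) -> smooth_on U (fun x => \det (A x)).
Proof.
move=> oU sA; apply: smooth_on_sum => // s _; apply: smooth_onM => //.
  exact: smooth_on_cst.
by apply: smooth_on_prod.
Qed.

Lemma smooth_on_invmx U k (A : 'rV[R]_m -> 'M[R]_k) : open U ->
  (forall x, U x -> A x \in unitmx) ->
  (forall a b, smooth_on U (fun x => A x a b)) ->
  forall a b, smooth_on U (fun x => invmx (A x) a b).
Proof.
move=> oU uA sA i j.
apply: (@smooth_on_eq _ (fun x => (\det (A x))^-1 * cofactor (A x) j i)) => //.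
  by move=> x Ux; rewrite /invmx uA // !mxE.
apply: smooth_onM => //.
  apply: smooth_onV => //; last exact: smooth_on_det.
  by move=> x /uA; rewrite unitmxE unitfE.
apply: smooth_onM => //; first exact: smooth_on_cst.
apply: smooth_on_det => // a b.
by apply: smooth_on_eq (sA (lift j a) (lift i b)) => // x _; rewrite !mxE.
Qed.

Lemma partialC U f i j x : open U -> smooth_on U f -> U x ->
  partial i (partial j f) x = partial j (partial i f) x.
Proof.
move=> oU sf Ux; apply: derive_swap; last 2 first.
- exact: (smooth_on_differentiable (smooth_on_partial j sf) Ux).
- exact: (smooth_on_differentiable (smooth_on_partial i sf) Ux).
by apply: filterS (open_nbhs_nbhs (conj oU Ux)) => y Uy;
  exact: smooth_on_differentiable sf Uy.
Qed.

Lemma partial_comp f (phi : 'rV[R]_m -> 'rV[R]_m) l x :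
  (forall i, differentiable (fun y => phi y 0 i) x) -> differentiable f (phi x) ->
  partial l (f \o phi) x = \sum_i partial i f (phi x) * partial l (fun y => phi y 0 i) x.
Proof.
move=> dphi df.
have phiE : phi = \sum_(i < m) (fun y => phi y 0 i *: delta_mx 0 i).
  by apply/funext => y; rewrite fct_sumE [LHS]row_sum_delta.
have dphi' i : differentiable (fun y => phi y 0 i *: (delta_mx 0 i : 'rV[R]_m)) x.
  exact: differentiableZl.
have dp : differentiable phi x by rewrite phiE; exact: differentiable_sum.
rewrite /partial (deriveE _ (differentiable_comp dp df)) diff_comp //=.
have E : 'D_(delta_mx 0 l) phi x =
    \sum_i 'D_(delta_mx 0 l) (fun y => phi y 0 i) x *: (delta_mx 0 i : 'rV[R]_m).
  rewrite {1}phiE derive_sum => [|i]; last exact: diff_derivable.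
  by apply: eq_bigr => i _; rewrite (deriveE _ (dphi' i)) diffZl // (deriveE _ (dphi i)).
rewrite -(deriveE _ dp) E linear_sum; apply: eq_bigr => i _.
by rewrite linearZ /= (deriveE _ df) [RHS]mulrC.
Qed.

Lemma differentiable_compp f (phi : 'rV[R]_m -> 'rV[R]_m) x :
  (forall i, differentiable (fun y => phi y 0 i) x) -> differentiable f (phi x) ->
  differentiable (f \o phi) x.
Proof.
move=> dphi df; apply: differentiable_comp df.
have -> : phi = \sum_(i < m) (fun y => phi y 0 i *: delta_mx 0 i).
  by apply/funext => y; rewrite fct_sumE [LHS]row_sum_delta.
by apply: differentiable_sum => i; exact: differentiableZl.
Qed.

End SmoothOn.
End Calculus.

(** * The exterior derivative in coordinates *)

Lemma bigfun_nil (T I Y : Type) (op : T -> T -> T) (idx : T) (F : I -> Y -> T) :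
  (fun y => \big[op/idx]_(z <- [::]) F z y) = fun=> idx.
Proof. by apply/funext => y; rewrite big_nil. Qed.

Lemma bigfun_cons (T I Y : Type) (op : T -> T -> T) (idx : T) (F : I -> Y -> T) a r :
  (fun y => \big[op/idx]_(z <- a :: r) F z y) =
  fun y => op (F a y) (\big[op/idx]_(z <- r) F z y).
Proof. by apply/funext => y; rewrite big_cons. Qed.

Section LocalForms.
Context {R : realType} {m : nat}.
Implicit Types (F G : 'rV[R]_m -> extalg R m) (U : set 'rV[R]_m) (x y : 'rV[R]_m).

Definition form_differentiable F x := forall S, differentiable (fun y => F y S) x.

Definition form_smooth_on U F := forall S, smooth_on U (fun y => F y S).

Definition form_partial i F x : extalg R m := [ffun S => partial i (fun y => F y S) x].

Definition ext_d F x : extalg R m :=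
  \sum_(i < m) ext_wedge (ext_dx i) (form_partial i F x).

Lemma form_smooth_differentiable U F x : form_smooth_on U F -> U x -> form_differentiable
  F x.
Proof. by move=> sF Ux S; exact: smooth_on_differentiable (sF S) Ux. Qed.

Lemma form_partial_near F G x i : (\forall y \near x, F y = G y) ->
  form_partial i F x = form_partial i G x.
Proof.
by move=> FG; apply/ffunP => S; rewrite !ffunE; apply: partial_near;
  apply: filterS FG => y ->.
Qed.

Lemma ext_d_near F G x : (\forall y \near x, F y = G y) -> ext_d F x = ext_d G x.
Proof. by move=> FG; apply: eq_bigr => i _; rewrite (form_partial_near i FG). Qed.

Lemma form_differentiableD F G x : form_differentiable F x -> form_differentiable G x ->
  form_differentiable (fun y => F y + G y) x.
Proof.
move=> dF dG S; have -> : (fun y => (F y + G y) S) = (fun y => F y S) + (fun y => G y S).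
  by apply/funext => y; rewrite ffunE.
exact: differentiableD.
Qed.

Lemma form_partialD F G x i : form_differentiable F x -> form_differentiable G x ->
  form_partial i (fun y => F y + G y) x = form_partial i F x + form_partial i G x.
Proof.
move=> dF dG; apply/ffunP => S; rewrite !ffunE -partialD //.
by congr (partial i _ x); apply/funext => y; rewrite ffunE.
Qed.

Lemma form_differentiableZ (f : 'rV[R]_m -> R) F x : differentiable f x ->
  form_differentiable F x ->
  form_differentiable (fun y => f y *: F y) x.
Proof.
move=> df dF S; have -> : (fun y => (f y *: F y) S) = f * (fun y => F y S).
  by apply/funext => y; rewrite ffunE.
exact: differentiableM.
Qed.

Lemma form_partialZ (f : 'rV[R]_m -> R) F x i : differentiable f x -> form_differentiable
  F x ->
  form_partial i (fun y => f y *: F y) x = partial i f x *: F x + f x *: form_partial i F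
    x.
Proof.
move=> df dF; apply/ffunP => S; rewrite !ffunE -partialM //.
by congr (partial i _ x); apply/funext => y; rewrite ffunE.
Qed.

Lemma form_partial_cst (a : extalg R m) i x : form_partial i (fun=> a) x = 0.
Proof. by apply/ffunP => S; rewrite !ffunE partial_cst. Qed.

Lemma form_differentiable_cst (a : extalg R m) x : form_differentiable (fun=> a) x.
Proof. by move=> S; exact: differentiable_cst. Qed.

Lemma form_differentiable_sum I (r : seq I) (F : I -> 'rV[R]_m -> extalg R m) x :
  (forall z, form_differentiable (F z) x) -> form_differentiable (fun y =>
    \sum_(z <- r) F z y) x.
Proof.
move=> dF; elim: r => [|z r IH].
  by rewrite bigfun_nil; exact: form_differentiable_cst.
by rewrite bigfun_cons; exact: form_differentiableD.
Qed.

Lemma form_partial_sum I (r : seq I) (F : I -> 'rV[R]_m -> extalg R m) x i :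
  (forall z, form_differentiable (F z) x) ->
  form_partial i (fun y => \sum_(z <- r) F z y) x = \sum_(z <- r) form_partial i (F z) x.
Proof.
move=> dF; elim: r => [|z r IH].
  by rewrite bigfun_nil big_nil form_partial_cst.
rewrite bigfun_cons big_cons form_partialD ?IH //.
exact: form_differentiable_sum.
Qed.

Lemma form_wedge_expand F G :
  (fun y => ext_wedge (F y) (G y)) =
  fun y => \sum_S \sum_T (F y S * G y T) *: ext_wedge (ext_base S) (ext_base T).
Proof.
apply/funext => y; rewrite {1}[F y]ext_expand ext_wedge_suml; apply: eq_bigr => S _.
rewrite {1}[G y]ext_expand ext_wedge_sumr; apply: eq_bigr => T _.
by rewrite ext_wedgeZl ext_wedgeZr scalerA.
Qed.

Lemma form_partial_wedge F G x i : form_differentiable F x -> form_differentiable G x ->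
  form_partial i (fun y => ext_wedge (F y) (G y)) x =
  ext_wedge (form_partial i F x) (G x) + ext_wedge (F x) (form_partial i G x).
Proof.
move=> dF dG; have dFG S T : differentiable (fun y => F y S * G y T) x.
  exact: (differentiableM (dF S) (dG T)).
have dt S T : form_differentiable
    (fun y => (F y S * G y T) *: ext_wedge (ext_base S) (ext_base T)) x.
  exact: (form_differentiableZ (dFG S T) (@form_differentiable_cst _ x)).
rewrite form_wedge_expand form_partial_sum => [|S]; last exact: form_differentiable_sum.
have E (a b : extalg R m) : ext_wedge a b =
    \sum_S \sum_T (a S * b T) *: ext_wedge (ext_base S) (ext_base T).
  exact: (congr1 (fun f => f x) (form_wedge_expand (fun=> a) (fun=> b))).
rewrite [ext_wedge _ (G x)]E [ext_wedge (F x) _]E -big_split; apply: eq_bigr => S _.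
rewrite form_partial_sum // -big_split; apply: eq_bigr => T _.
rewrite (form_partialZ i (dFG S T) (@form_differentiable_cst _ x)) form_partial_cst
  scaler0 addr0.
by rewrite /= -scalerDl !ffunE partialM.
Qed.

Lemma ext_dD F G x : form_differentiable F x -> form_differentiable G x ->
  ext_d (fun y => F y + G y) x = ext_d F x + ext_d G x.
Proof.
move=> dF dG; rewrite -big_split; apply: eq_bigr => i _.
by rewrite form_partialD // ext_wedgeDr.
Qed.

Lemma ext_dZ (k : R) F x : form_differentiable F x ->
  ext_d (fun y => k *: F y) x = k *: ext_d F x.
Proof.
move=> dF; rewrite scaler_sumr; apply: eq_bigr => i _.
rewrite (form_partialZ i (differentiable_cst k x) dF).
by rewrite partial_cst scale0r add0r ext_wedgeZr.
Qed.

Lemma ext_d_wedge F G x : form_differentiable F x -> form_differentiable G x ->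
  ext_d (fun y => ext_wedge (F y) (G y)) x =
  ext_wedge (ext_d F x) (G x) + ext_wedge (ext_grade (F x)) (ext_d G x).
Proof.
move=> dF dG; rewrite /ext_d ext_wedge_suml ext_wedge_sumr -big_split;
  apply: eq_bigr => i _ /=.
rewrite form_partial_wedge // ext_wedgeDr !ext_wedgeA; congr (_ + ext_wedge _ _).
rewrite ext_wedge_dx; congr (ext_wedge _ _); apply/ffunP => S;
  rewrite !ffunE mulrA -exprD addnn.
by rewrite -mul2n exprM sqrrN !expr1n mul1r.
Qed.

Lemma form_smooth_partial U F i : form_smooth_on U F -> form_smooth_on U (form_partial i
  F).
Proof.
move=> sF S; have -> : (fun y => form_partial i F y S) = partial i (fun y => F y S).
  by apply/funext => y; rewrite ffunE.
exact: smooth_on_partial.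
Qed.

Lemma form_smooth_wedge U F G : open U -> form_smooth_on U F -> form_smooth_on U G ->
  form_smooth_on U (fun y => ext_wedge (F y) (G y)).
Proof.
move=> oU sF sG S; apply: (@smooth_on_eq _ _ U (fun y =>
  \sum_(T : {set 'I_m} | T \subset S)
    (-1) ^+ inversions T (S :\: T)%SET * F y T * G y (S :\: T)%SET)) => // [y _|].
  by rewrite ffunE.
apply: smooth_on_sum => // T _; apply: smooth_onM => //; apply: smooth_onM => //.
exact: smooth_on_cst.
Qed.

Lemma form_smooth_cst U (a : extalg R m) : open U -> form_smooth_on U (fun=> a).
Proof. by move=> oU S; exact: smooth_on_cst. Qed.

Lemma form_smooth_sum U I (r : seq I) (F : I -> 'rV[R]_m -> extalg R m) : open U ->
  (forall z, form_smooth_on U (F z)) -> form_smooth_on U (fun y => \sum_(z <- r) F z y).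
Proof.
move=> oU sF S; apply: (@smooth_on_eq _ _ U (fun y => \sum_(z <- r) F z y S)) => //
  [y _|].
  by rewrite sum_ffunE.
by apply: smooth_on_sum => // z _; exact: sF.
Qed.

Lemma form_smoothZ U (f : 'rV[R]_m -> R) F : open U -> smooth_on U f -> form_smooth_on U
  F ->
  form_smooth_on U (fun y => f y *: F y).
Proof.
move=> oU sf sF S; apply: smooth_on_eq (smooth_onM oU sf (sF S)) => // y _.
by rewrite ffunE.
Qed.

Lemma form_smooth_eq U F G : open U -> (forall x, U x -> F x = G x) ->
  form_smooth_on U F -> form_smooth_on U G.
Proof. by move=> oU FG sF S; apply: smooth_on_eq (sF S) => // x /FG ->. Qed.

Lemma ext_d_smooth U F : open U -> form_smooth_on U F -> form_smooth_on U (ext_d F).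
Proof.
move=> oU sF; apply: form_smooth_sum => // i; apply: form_smooth_wedge => //.
  exact: form_smooth_cst.
exact: form_smooth_partial.
Qed.

Lemma ext_dd U F x : open U -> form_smooth_on U F -> U x -> ext_d (ext_d F) x = 0.
Proof.
move=> oU sF Ux; pose t i j := ext_wedge (ext_wedge (ext_dx i) (ext_dx j)) (form_partial
  i (form_partial j F) x).
have -> : ext_d (ext_d F) x = \sum_i \sum_j t i j.
  apply: eq_bigr => i _; rewrite /ext_d form_partial_sum; last first.
    move=> j; apply: (form_smooth_differentiable _ Ux); apply: form_smooth_wedge => //.
      exact: form_smooth_cst.
    exact: form_smooth_partial.
  rewrite ext_wedge_sumr; apply: eq_bigr => j _.
  rewrite (form_partial_wedge i (@form_differentiable_cst (ext_dx j) x)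
    (form_smooth_differentiable (form_smooth_partial j sF) Ux)).
  by rewrite form_partial_cst ext_wedge0l add0r ext_wedgeA.
have tC i j : t i j = - t j i.
  have C : form_partial i (form_partial j F) x = form_partial j (form_partial i F) x.
    apply/ffunP => S; rewrite [LHS]ffunE [RHS]ffunE.
    have E k : (fun y => form_partial k F y S) = partial k (fun y => F y S).
      by apply/funext => y; rewrite ffunE.
    by rewrite !E; apply: partialC oU (sF S) Ux.
  by rewrite /t C ext_dxC ext_wedgeNl.
set s := \sum_i _; have : s = - s.
  by rewrite {1}/s exchange_big /= -sumrN; apply: eq_bigr => i _; rewrite -sumrN;
    apply: eq_bigr.
move=> /eqP; rewrite -addr_eq0 -mulr2n => /eqP s2.
by apply: (scalerI (a := 2%:R)); rewrite ?pnatr_eq0 // scaler0 scaler_nat.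
Qed.

Definition jacobian (phi : 'rV[R]_m -> 'rV[R]_m) x : 'M[R]_m :=
  \matrix_(i, l) partial l (fun y => phi y 0 i) x.

Lemma ext_d_pullback U (phi : 'rV[R]_m -> 'rV[R]_m) G x : open U ->
  (forall i, smooth_on U (fun y => phi y 0 i)) -> U x -> form_differentiable G (phi x) ->
  ext_d (fun y => ext_pullback (jacobian phi y) (G (phi y))) x =
  ext_pullback (jacobian phi x) (ext_d G (phi x)).
Proof.
move=> oU sphi Ux dG.
pose v i y : extalg R m := \sum_l jacobian phi y i l *: ext_dx l.
have vE i : v i = ext_d (fun y => phi y 0 i *: ext_one).
  apply/funext => y; apply: eq_bigr =>
    l _; rewrite mxE -[ext_dx l in LHS]ext_wedge1r -ext_wedgeZr.
  congr (ext_wedge _ _); apply/ffunP => S; rewrite !ffunE.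
  have [S0|S0] := eqVneq S finset.set0; last first.
    rewrite /GRing.scale /= mulr0 -[LHS](partial_cst 0 l y); congr (partial _ _ _).
    by apply/funext => z; rewrite !ffunE (negPf S0) /GRing.scale /= mulr0.
  rewrite /GRing.scale /= mulr1; congr (partial _ _ _).
  by apply/funext => z; rewrite !ffunE S0 eqxx /GRing.scale /= mulr1.
have s1 i : form_smooth_on U (fun y => phi y 0 i *: (ext_one : extalg R m)).
  by apply: form_smoothZ => //; exact: form_smooth_cst.
have sv i : form_smooth_on U (v i) by rewrite vE; exact: ext_d_smooth.
have dv i y : U y -> ext_d (v i) y = 0 by rewrite vE; exact: ext_dd.
pose P (s : seq 'I_m) y := \big[ext_wedge/ext_one]_(i <- s) v i y.
have sP s : form_smooth_on U (P s).
  elim: s => [|i s IH]; rewrite /P.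
    by rewrite bigfun_nil; exact: form_smooth_cst.
  by rewrite bigfun_cons; exact: form_smooth_wedge.
have dP s : ext_d (P s) x = 0.
  elim: s => [|i s IH]; rewrite /P.
    rewrite bigfun_nil /ext_d big1 // => i _.
    by rewrite form_partial_cst ext_wedge0r.
  rewrite bigfun_cons ext_d_wedge.
  - by rewrite dv // IH ext_wedge0l ext_wedge0r addr0.
  - exact: form_smooth_differentiable (sv i) Ux.
  - exact: form_smooth_differentiable (sP s) Ux.
have dphi i : differentiable (fun y =>
  phi y 0 i) x by exact: smooth_on_differentiable (sphi i) Ux.
have dGS S : differentiable (fun y => G (phi y) S) x.
  exact: (differentiable_compp (f := fun z => G z S) dphi (dG S)).
have dPS S : form_differentiable (P (enum S)) x by exact: form_smooth_differentiable (sP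
  _) Ux.
rewrite /ext_d linear_sum /=.
have -> : (fun y => ext_pullback (jacobian phi y) (G (phi y))) =
    fun y => \sum_(S : {set 'I_m}) G (phi y) S *: P (enum S) y by [].
transitivity (\sum_i \sum_(S : {set 'I_m})
    partial i (fun y => G (phi y) S) x *: ext_wedge (ext_dx i) (P (enum S) x)).
  under eq_bigr => i _.
    rewrite form_partial_sum; last by move=> S; exact: form_differentiableZ.
    rewrite ext_wedge_sumr.
    under eq_bigr => S _ do rewrite form_partialZ // ext_wedgeDr !ext_wedgeZr.
    rewrite big_split /=.
    over.
  rewrite big_split /= [X in _ + X](_ : _ = 0) ?addr0 // exchange_big /= big1 // => S _.
  by rewrite -scaler_sumr -[X in _ *: X]/(ext_d (P (enum S)) x) dP scaler0.
under [RHS]eq_bigr do rewrite ext_pullback_dx_wedge /ext_pullback ext_wedge_sumr.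
rewrite exchange_big [RHS]exchange_big /=; apply: eq_bigr => S _.
transitivity (ext_wedge (\sum_i partial i (fun y =>
  G (phi y) S) x *: ext_dx i) (P (enum S) x)).
  by rewrite ext_wedge_suml; apply: eq_bigr => i _; rewrite ext_wedgeZl.
transitivity (ext_wedge (\sum_i partial i (fun z =>
  G z S) (phi x) *: v i x) (P (enum S) x)).
  congr (ext_wedge _ _); rewrite /v ext_oneform_sum; apply: eq_bigr => l _;
    congr (_ *: _).
  rewrite -[LHS]/(partial l ((fun z => G z S) \o phi) x) partial_comp //.
  by apply: eq_bigr => i _; rewrite mxE.
rewrite ext_wedge_suml; apply: eq_bigr => i _.
by rewrite ffunE ext_wedgeZl ext_wedgeZr.
Qed.

End LocalForms.

(** * Forms on a manifold *)

Section ManifoldForms.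
Context {R : realType} {m : nat} {M : manifold R m}.
Implicit Types (A B : form_field M) (c : chart M) (x : M) (k l : nat).

Definition chart_img c : set 'rV[R]_m := chart_coord c @` chart_dom c.

Definition local_form c A : 'rV[R]_m -> extalg R m := fun y => A c (chart_param c y).

Lemma chart_imgP c y : chart_img c y ->
  chart_dom c (chart_param c y) /\ chart_coord c (chart_param c y) = y.
Proof. by move=> [x cx <-]; rewrite chart_coordK. Qed.

Lemma chart_img_coord c x : chart_dom c x -> chart_img c (chart_coord c x).
Proof. by move=> cx; exists x. Qed.

Lemma chart_img_openT c : open (chart_img c).
Proof. exact: chart_img_open. Qed.

Lemma local_form_coord c A x : chart_dom c x -> local_form c A (chart_coord c x) = A c x.
Proof. by move=> cx; rewrite /local_form chart_coordK. Qed.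

Lemma is_form_smooth k A c : is_form k A -> form_smooth_on (chart_img c) (local_form c A).
Proof. by move=> fA S; exact: form_smooth fA c S. Qed.

Lemma is_form_differentiable k A c x : is_form k A -> chart_dom c x ->
  form_differentiable (local_form c A) (chart_coord c x).
Proof.
move=> fA cx.
exact: (form_smooth_differentiable (is_form_smooth fA) (chart_img_coord cx)).
Qed.

Lemma d_ext_d A c x : chart_dom c x -> d A c x = ext_d (local_form c A) (chart_coord c x).
Proof. by move=> cx; rewrite /d mem_set. Qed.

Lemma d_out A c x : ~ chart_dom c x -> d A c x = 0.
Proof. by move=> cx; rewrite /d memNset. Qed.

Lemma form_eq A B : (forall c x, A c x = B c x) -> A = B.
Proof. by move=> AB; apply/funext => c; apply/funext => x. Qed.

Lemma form_fieldDE A B c x : (A + B) c x = A c x + B c x. Proof. by []. Qed.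
Lemma form_fieldZE (a : R) A c x : (a *: A) c x = a *: A c x. Proof. by []. Qed.
Lemma form_field0E c x : (0 : form_field M) c x = 0. Proof. by []. Qed.

Lemma is_form0 k : is_form k (0 : form_field M).
Proof.
split=> [//|c x S _|c S|c c' x _ _].
- by rewrite ffunE.
- apply: (smooth_on_eq (f := fun=> 0)) => [|y _|]; first exact: chart_img_open.
    by rewrite ffunE.
  by apply: smooth_on_cst; exact: chart_img_open.
- by rewrite linear0.
Qed.

Lemma is_formP k (a : R) A B : is_form k A -> is_form k B -> is_form k (a *: A + B).
Proof.
move=> fA fB; split=> [c x cx|c x S nS|c S|c c' x cx c'x].
- by rewrite form_fieldDE form_fieldZE !(form_out fA, form_out fB) // scaler0 addr0.
- by rewrite form_fieldDE form_fieldZE !ffunE (form_degree fA) // (form_degree fB) //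
  scaler0 addr0.
- have oU : open (chart_img c) := @chart_img_openT c.
  apply: (smooth_on_eq (f := fun y =>
    a * A c (chart_param c y) S + B c (chart_param c y) S)) => // [y _|].
    by rewrite form_fieldDE form_fieldZE !ffunE.
  apply: smooth_onD => //; last exact: form_smooth fB c S.
  by apply: smooth_onM => //; [exact: smooth_on_cst|exact: form_smooth fA c S].
- rewrite !form_fieldDE !form_fieldZE linearP /=.
  by rewrite -(form_compatible fA cx c'x) -(form_compatible fB cx c'x).
Qed.

Lemma is_formD k A B : is_form k A -> is_form k B -> is_form k (A + B).
Proof. by move=> fA fB; rewrite -[A]scale1r; exact: is_formP. Qed.

Lemma is_formZ k (a : R) A : is_form k A -> is_form k (a *: A).
Proof. by move=> fA; rewrite -[_ *: _]addr0; apply: is_formP => //; exact: is_form0. Qed.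

Lemma is_formN k A : is_form k A -> is_form k (- A).
Proof. by move=> fA; rewrite -scaleN1r; exact: is_formZ. Qed.

Lemma is_form_sum k I (r : seq I) (P : pred I) (F : I -> form_field M) :
  (forall i, P i -> is_form k (F i)) -> is_form k (\sum_(i <- r | P i) F i).
Proof. by move=> fF; apply: big_ind => //; [exact: is_form0|exact: is_formD]. Qed.

Lemma is_form_gt k A : (m < k)%N -> is_form k A -> A = 0.
Proof.
move=> mk fA; apply: form_eq => c x; apply/ffunP => S; rewrite form_field0E ffunE.
apply: (form_degree fA); apply: contraTneq mk => <-.
by rewrite -leqNgt -[X in (_ <= X)%N]card_ord max_card.
Qed.

Lemma is_form_wedge k l A B : is_form k A -> is_form l B -> is_form (k + l) (wedge A B).
Proof.
move=> fA fB; split=> [c x cx|c x|c|c c' x cx c'x].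
- by rewrite /wedge (form_out fA) // ext_wedge0l.
- exact: (ext_wedge_homogeneous (@form_degree _ _ _ _ _ fA c x) (@form_degree _ _ _ _ _
  fB c x)).
- apply: form_smooth_wedge; [exact: chart_img_open|exact: is_form_smooth fA|exact:
  is_form_smooth fB].
- rewrite /wedge ext_pullback_wedge.
  by rewrite -(form_compatible fA cx c'x) -(form_compatible fB cx c'x).
Qed.

Lemma wedge_linear A : linear (wedge A).
Proof. by move=> a B C; apply: form_eq => c x; rewrite /wedge ext_wedgeDr ext_wedgeZr.
Qed.
HB.instance Definition _ A :=
  GRing.isLinear.Build R (form_field M) (form_field M) _ (wedge A) (wedge_linear A).

Definition wedger B A := wedge A B.

Lemma wedger_linear B : linear (wedger B).
Proof. by move=> a A C; apply: form_eq => c x;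
  rewrite /wedger /wedge ext_wedgeDl ext_wedgeZl. Qed.
HB.instance Definition _ B :=
  GRing.isLinear.Build R (form_field M) (form_field M) _ (wedger B) (wedger_linear B).

Lemma wedgeA A B C : wedge A (wedge B C) = wedge (wedge A B) C.
Proof. by apply: form_eq => c x; exact: ext_wedgeA. Qed.

Lemma wedgeC k l A B : is_form k A -> is_form l B ->
  wedge B A = (-1) ^+ (k * l) *: wedge A B.
Proof.
move=> fA fB; apply: form_eq => c x.
exact: (ext_wedgeC (@form_degree _ _ _ _ _ fA c x) (@form_degree _ _ _ _ _ fB c x)).
Qed.

Lemma form_grade k A c x : is_form k A -> ext_grade (A c x) = (-1) ^+ k *: A c x.
Proof. by move=> fA; exact: (ext_grade_homogeneous (@form_degree _ _ _ _ _ fA c x)). Qed.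

Lemma dP k (a : R) A B : is_form k A -> is_form k B -> d (a *: A + B) = a *: d A + d B.
Proof.
move=> fA fB; apply: form_eq => c x; rewrite form_fieldDE form_fieldZE.
have [cx|cx] := pselect (chart_dom c x); last by rewrite !d_out // scaler0 addr0.
rewrite !d_ext_d //; have dA := is_form_differentiable fA cx;
  have dB := is_form_differentiable fB cx.
rewrite -ext_dZ // -ext_dD //.
by move=> S; exact: (form_differentiableZ (differentiable_cst a _) dA).
Qed.

Lemma d_wedge k l A B : is_form k A -> is_form l B ->
  d (wedge A B) = wedge (d A) B + (-1) ^+ k *: wedge A (d B).
Proof.
move=> fA fB; apply: form_eq => c x; rewrite form_fieldDE form_fieldZE /wedge.
have [cx|cx] := pselect (chart_dom c x); last first.
  by rewrite !d_out // ext_wedge0l ext_wedge0r scaler0 addr0.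
rewrite !d_ext_d //; have dA := is_form_differentiable fA cx;
  have dB := is_form_differentiable fB cx.
rewrite -[LHS]/(ext_d (fun y => ext_wedge (local_form c A y) (local_form c B y)) _).
rewrite ext_d_wedge // !local_form_coord //; congr (_ + _).
by rewrite (form_grade c x fA) ext_wedgeZl.
Qed.

Lemma local_d A c y : chart_img c y -> local_form c (d A) y = ext_d (local_form c A) y.
Proof. by move=> /chart_imgP[cy yE]; rewrite /local_form d_ext_d // yE. Qed.

Lemma d_d k A : is_form k A -> d (d A) = 0.
Proof.
move=> fA; apply: form_eq => c x; rewrite form_field0E.
have [cx|cx] := pselect (chart_dom c x); last by rewrite d_out.
rewrite d_ext_d // (@ext_d_near _ _ _ (ext_d (local_form c A))); last first.
  have := open_nbhs_nbhs (conj (@chart_img_openT c) (chart_img_coord cx)).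
  by apply: filterS => y cy; exact: local_d.
apply: (ext_dd (@chart_img_openT c) _ (chart_img_coord cx)); exact: is_form_smooth fA.
Qed.

Definition transition c c' : 'rV[R]_m -> 'rV[R]_m := fun y =>
  chart_coord c' (chart_param c y).

Definition transition_dom c c' : set 'rV[R]_m :=
  chart_coord c @` (chart_dom c `&` chart_dom c').

Lemma transition_domP c c' y : transition_dom c c' y <->
  chart_img c y /\ chart_dom c' (chart_param c y).
Proof.
split=> [[x [cx c'x] <-]|[cy c'y]].
  by split; [exact: chart_img_coord|rewrite chart_coordK].
by have [cpy yE] := chart_imgP cy; exists (chart_param c y).
Qed.

Lemma transition_dom_open c c' : open (transition_dom c c').
Proof.
rewrite openE => y /transition_domP[cy c'y].
have cp : {for y, continuous (chart_param c)}.
  have := @chart_param_continuous _ _ M c.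
  rewrite continuous_open_subspace; last exact: chart_img_open.
  by apply; rewrite inE.
have n1 := open_nbhs_nbhs (conj (@chart_img_openT c) cy).
have n2 := cp _ (open_nbhs_nbhs (conj (@chart_dom_open _ _ M c') c'y)).
near=> z; apply/transition_domP; split; near: z; [exact: n1|exact: n2].
Unshelve. all: by end_near. Qed.

Lemma transition_jacobianE c c' y : chart_img c y ->
  transition_jacobian c c' (chart_param c y) = jacobian (transition c c') y.
Proof. by move=> /chart_imgP[cy yE]; apply/matrixP => i l; rewrite !mxE yE. Qed.

Lemma is_form_d k A : is_form k A -> is_form k.+1 (d A).
Proof.
move=> fA; split=> [c x|c x|c|c c' x cx c'x].
- exact: d_out.
- have [cx|cx] := pselect (chart_dom c x); last by rewrite d_out // => S _; rewrite ffunE.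
  rewrite d_ext_d // => S nS; rewrite sum_ffunE big1 // => i _.
  apply: (@ext_wedge_homogeneous _ _ 1 k) => // T nT.
    by rewrite ffunE; have [TE|//] := eqVneq T [set i]%SET; rewrite TE cards1 in nT.
  rewrite ffunE (_ : (fun y => _) = fun=> 0) ?partial_cst //.
  by apply/funext => y; exact: (form_degree fA).
- apply: (form_smooth_eq (F := ext_d (local_form c A))).
  + exact: chart_img_open.
  + by move=> y cy; rewrite -local_d.
  + by apply: ext_d_smooth; [exact: chart_img_open|exact: is_form_smooth fA].
- rewrite !d_ext_d //.
  have xW : transition_dom c c' (chart_coord c x).
    by apply/transition_domP; rewrite chart_coordK //; split => //;
      exact: chart_img_coord.
  have phix : transition c c' (chart_coord c x) = chart_coord c' x.
    by rewrite /transition chart_coordK.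
  rewrite -[in RHS]phix -[x in transition_jacobian c c' x](chart_coordK cx).
  rewrite transition_jacobianE; last exact: chart_img_coord.
  rewrite -(ext_d_pullback (@transition_dom_open c c') _ xW).
  + apply: ext_d_near; have := open_nbhs_nbhs (conj (@transition_dom_open c c') xW).
    apply: filterS => y /transition_domP[cy c'y].
    have [cpy yE] := chart_imgP cy.
    rewrite /local_form (form_compatible fA cpy c'y) transition_jacobianE //.
    by rewrite /transition chart_coordK.
  + by move=> i; exact: chart_transition_smooth.
  + by rewrite phix; exact: is_form_differentiable fA c'x.
Qed.

End ManifoldForms.

(** * Contraction with the Poisson bivector *)

Lemma form_smooth_inner (R : realType) (m : nat) (U : set 'rV[R]_m)
    (F : 'rV[R]_m -> extalg R m) (j : 'I_m) :
  open U -> form_smooth_on U F -> form_smooth_on U (fun y => ext_inner j (F y)).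
Proof.
move=> oU sF S; apply: (smooth_on_eq (f := fun y => if j \in S then 0 else
    (-1) ^+ inversions [set j]%SET S * F y (j |: S)%SET)) => // [y _|].
  by rewrite ffunE.
case: (j \in S); first exact: smooth_on_cst.
by apply: smooth_onM => //; exact: smooth_on_cst.
Qed.

Section SymplecticForms.
Context {R : realType} {n : nat} {M : symplectic_manifold R n}.
Implicit Types (A B : form_field M) (c : chart M) (x : M) (k : nat).

Lemma is_form_omega : is_form 2 (omega M).
Proof. exact: symplectic_form (omega_symplectic M). Qed.

Lemma gram_omega_unit c x : chart_dom c x -> ext_gram (omega M c x) \in unitmx.
Proof.
move=> cx; rewrite -row_free_unit -kermx_eq0; apply/eqP/row_matrixP => i; rewrite row0.
apply: (symplectic_nondegenerate (omega_symplectic M) cx) => v.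
by rewrite -row_mul mulmx_ker row0 mul0mx.
Qed.

Definition poisson c x : 'M[R]_(2 * n) := invmx (ext_gram (omega M c x)).

Definition Lam A : form_field M := fun c x => ext_lam (poisson c x) (A c x).

Lemma Lam_linear : linear Lam.
Proof. by move=> a A B; apply: form_eq => c x; rewrite /Lam linearP. Qed.
HB.instance Definition _ :=
  GRing.isLinear.Build R (form_field M) (form_field M) _ Lam Lam_linear.

Lemma Lam_L k A : is_form k A ->
  Lam (L A) = L (Lam A) + (n%:R - k%:R) *: A.
Proof.
move=> fA; apply: form_eq => c x; rewrite form_fieldDE form_fieldZE.
have [cx|cx] := pselect (chart_dom c x); last first.
  by rewrite /L /Lam /wedge !(form_out fA) // !linear0 addr0.
rewrite /Lam /L /wedge /poisson (ext_lam_wedge (k := k)).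
- by rewrite natrM mulrA mulVf ?mul1r // pnatr_eq0.
- exact: (@form_degree _ _ _ _ _ is_form_omega c x).
- exact: (@form_degree _ _ _ _ _ fA c x).
- exact: gram_omega_unit.
Qed.

Lemma poisson_transition c c' x : chart_dom c x -> chart_dom c' x ->
  let J := transition_jacobian c c' x in J *m poisson c x *m J^T = poisson c' x.
Proof.
move=> cx c'x J; have wJ := form_compatible is_form_omega cx c'x; rewrite -/J in wJ.
have GJ : ext_gram (omega M c x) = J^T *m ext_gram (omega M c' x) *m J.
  rewrite wJ; apply: ext_gram_pullback; last rewrite -wJ;
    exact: (@form_degree _ _ _ _ _ is_form_omega).
have uG := gram_omega_unit cx; have uG' := gram_omega_unit c'x.
have uJ : J \in unitmx by move: uG; rewrite GJ unitmx_mul => /andP[].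
rewrite -[LHS]mulmx1 -(mulmxV uG') mulmxA [X in X *m _](_ : _ = 1%:M) ?mul1mx //.
have E : J^T *m ext_gram (omega M c' x) = ext_gram (omega M c x) *m invmx J.
  by rewrite GJ mulmxK.
by rewrite -mulmxA E mulmxA -(mulmxA J) mulVmx // mulmx1 mulmxV.
Qed.

Lemma is_form_Lam k A : is_form k.+2 A -> is_form k (Lam A).
Proof.
move=> fA; split=> [c x cx|c x|c|c c' x cx c'x].
- by rewrite /Lam (form_out fA) // linear0.
- exact: (ext_lam_homogeneous _ (@form_degree _ _ _ _ _ fA c x)).
- have oU : open (chart_img c) := @chart_img_openT _ _ _ c.
  have sP i l : smooth_on (chart_img c) (fun y => poisson c (chart_param c y) i l).
    apply: smooth_on_invmx => // [y cy|a b]; first by have [cpy _] := chart_imgP cy;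
      exact: gram_omega_unit.
    have sw S := @form_smooth _ _ _ _ _ is_form_omega c S.
    apply: (smooth_on_eq (f := fun y =>
      if (a < b)%N then omega M c (chart_param c y) [set a; b]%SET
       else if (b < a)%N then -1 * omega M c (chart_param c y) [set a;
         b]%SET else 0)) => // [y _|].
      by rewrite mxE mulN1r.
    case: (a < b)%N; first exact: sw.
    case: (b < a)%N; last exact: smooth_on_cst.
    by apply: smooth_onM => //; exact: smooth_on_cst.
  apply: (form_smoothZ oU (smooth_on_cst 2^-1 oU)).
  apply: form_smooth_sum => // i; apply: form_smooth_sum => // l;
    apply: form_smoothZ => //.
  exact: (form_smooth_inner _ oU (form_smooth_inner _ oU (is_form_smooth fA))).
- rewrite /Lam (form_compatible fA cx c'x); apply: ext_lam_pullback.
  exact: poisson_transition.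
Qed.

Lemma Lam_eq0 k A : (k < 2)%N -> is_form k A -> Lam A = 0.
Proof.
move=> k2 fA; apply: form_eq => c x; rewrite form_field0E.
exact: (ext_lam_homogeneous0 _ k2 (@form_degree _ _ _ _ _ fA c x)).
Qed.

End SymplecticForms.

(** * The Lefschetz decomposition *)

Section LefschetzTheory.
Context {R : realType} {n : nat} {M : symplectic_manifold R n}.
Implicit Types (A B C : form_field M) (k s r t p q : nat).

Lemma L0 : L 0 = 0 :> form_field M.
Proof. exact: (linear0 (wedge (omega M))). Qed.

Lemma LD A B : L (A + B) = L A + L B.
Proof. exact: (linearD (wedge (omega M))). Qed.

Lemma LB A B : L (A - B) = L A - L B.
Proof. exact: (linearB (wedge (omega M))). Qed.

Lemma LZ (a : R) A : L (a *: A) = a *: L A.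
Proof. by rewrite /L linearZ. Qed.

Lemma L_sum I (r : seq I) (P : pred I) (F : I -> form_field M) :
  L (\sum_(i <- r | P i) F i) = \sum_(i <- r | P i) L (F i).
Proof. exact: (linear_sum (wedge (omega M))). Qed.

Lemma iterL_linear t : linear (iter t (@L R n M)).
Proof.
by elim: t => [//|t IH] a A B; rewrite !iterS IH LD LZ.
Qed.
HB.instance Definition _ t :=
  GRing.isLinear.Build R (form_field M) (form_field M) _ (iter t (@L R n M))
    (iterL_linear t).

Lemma iterL0 t : iter t (@L R n M) 0 = 0.
Proof. exact: linear0. Qed.

Lemma iterLD t A B : iter t L (A + B) = iter t L A + iter t L B.
Proof. exact: linearD. Qed.

Lemma iterLN t A : iter t L (- A) = - iter t L A.
Proof. exact: linearN. Qed.

Lemma iterLB t A B : iter t L (A - B) = iter t L A - iter t L B.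
Proof. exact: linearB. Qed.

Lemma iterLZ t (a : R) A : iter t L (a *: A) = a *: iter t L A.
Proof. by rewrite linearZ. Qed.

Lemma iterL_sum t I (r : seq I) (P : pred I) (F : I -> form_field M) :
  iter t L (\sum_(i <- r | P i) F i) = \sum_(i <- r | P i) iter t L (F i).
Proof. exact: linear_sum. Qed.

Lemma iterL_add t u A : iter t L (iter u L A) = iter (t + u) L A.
Proof. by rewrite iterD. Qed.

Lemma iterL_sub t u A : (u <= t)%N -> iter u L A = 0 -> iter t L A = 0.
Proof. by move=> ut A0; rewrite -(subnK ut) iterD A0 iterL0. Qed.

Lemma is_form_iterL k t A : is_form k A -> is_form (k + 2 * t) (iter t L A).
Proof.
move=> fA; elim: t => [|t IH]; first by rewrite addn0.
have -> : (k + 2 * t.+1 = 2 + (k + 2 * t))%N by lia.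
by rewrite iterS; apply: is_form_wedge => //; exact: is_form_omega.
Qed.

Lemma iterL_gt k t A : is_form k A -> (2 * n < k + 2 * t)%N -> iter t L A = 0.
Proof. by move=> fA kt; apply: is_form_gt kt _; exact: is_form_iterL. Qed.

(* [form_sub e k A]: the form A has degree k - e, with forms of negative degree being 0. *)
Definition form_sub e k A : Prop := if (e <= k)%N then is_form (k - e) A else A = 0.

Lemma form_sub0 e k : form_sub e k (0 : form_field M).
Proof. by rewrite /form_sub; case: ifP => // _; exact: is_form0. Qed.

Lemma form_subD e k A B : form_sub e k A -> form_sub e k B -> form_sub e k (A + B).
Proof.
rewrite /form_sub; case: ifP => _; first exact: is_formD.
by move=> -> ->; rewrite addr0.
Qed.

Lemma form_subZ e k (a : R) A : form_sub e k A -> form_sub e k (a *: A).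
Proof.
rewrite /form_sub; case: ifP => _; first exact: is_formZ.
by move=> ->; rewrite scaler0.
Qed.

Lemma form_subN e k A : form_sub e k A -> form_sub e k (- A).
Proof. by move=> fA; rewrite -scaleN1r; exact: form_subZ. Qed.

Lemma form_sub_iterL t e k A : form_sub e k A -> (e <= 2 * t)%N ->
  is_form (k + 2 * t - e) (iter t L A).
Proof.
rewrite /form_sub => + et; case: ifP => ek fA.
  have -> : (k + 2 * t - e = k - e + 2 * t)%N by lia.
  exact: is_form_iterL.
by rewrite fA iterL0; exact: is_form0.
Qed.

Lemma Lam_form_sub k A : is_form k A -> form_sub 2 k (Lam A).
Proof.
rewrite /form_sub; case: ifP => [k2 fA|k2 /Lam_eq0 -> //].
  have kE : (k - 2).+2 = k by lia.
  by apply: is_form_Lam; rewrite kE.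
by rewrite ltnNge k2.
Qed.

Lemma Lam_iterL k t A : is_form k A ->
  Lam (iter t.+1 L A) = iter t.+1 L (Lam A) + (t.+1%:R * (n%:R - k%:R - t%:R)) *: iter t
    L A.
Proof.
move=> fA; elim: t => [|t IH]; first by rewrite /= (Lam_L fA) subr0 mul1r.
rewrite iterS (Lam_L (is_form_iterL t.+1 fA)) IH LD LZ -addrA; congr (_ + _).
rewrite -[L (iter t L A)]/(iter t.+1 L A) -scalerDl; congr (_ *: _).
by rewrite natrD natrM -!natr1; ring.
Qed.

(* Applying [Lam] to L^(t+1) A = 0 gives L^(t+1) Lam A = - c L^t A with c > 0, hence
   L^(t+2) Lam A = 0, and Lam A has lower degree. *)
Lemma iterL_inj k t A : is_form k A -> (t + k <= n)%N -> iter t L A = 0 -> A = 0.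
Proof.
elim/ltn_ind: k t A => k IHk t A fA; elim: t => [//|t IHt] tk tA.
have := Lam_iterL t fA; rewrite tA linear0 => /esym /eqP; rewrite addr_eq0 => /eqP LtA.
have LA : Lam A = 0.
  have := Lam_form_sub fA; rewrite /form_sub; case: ifP => [k2 fL|//].
  apply: (IHk (k - 2)%N _ t.+2) => //; [lia|lia|].
  by rewrite iterS LtA -scaleNr LZ -[L _]/(iter t.+1 L A) tA scaler0.
apply: IHt; first lia.
move: LtA; rewrite LA iterL0 => /esym /eqP; rewrite oppr_eq0 scaler_eq0 => /orP[|/eqP //].
rewrite mulf_eq0 pnatr_eq0 /= -addrA -opprD -natrD subr_eq0 eqr_nat; lia.
Qed.

Lemma primitive0 s : primitive s (0 : form_field M).
Proof. by rewrite /primitive; case: ifP => // _; split; [exact: is_form0|exact: iterL0].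
Qed.

Lemma primitiveP s (a : R) A B : primitive s A -> primitive s B -> primitive s (a *: A +
  B).
Proof.
rewrite /primitive; case: ifP => _; last by move=> -> ->; rewrite scaler0 addr0.
move=> [fA A0] [fB B0]; split; first exact: is_formP.
by rewrite iterLD iterLZ A0 B0 scaler0 addr0.
Qed.

Lemma primitive_form s A : primitive s A -> is_form s A.
Proof. by rewrite /primitive; case: ifP => [_ []//|_ ->]; exact: is_form0. Qed.

Lemma primitive_iterL s t A : primitive s A -> (n < t + s)%N -> iter t L A = 0.
Proof.
rewrite /primitive; case: ifP => [sn [_ A0] ts|_ -> _]; last exact: iterL0.
by apply: iterL_sub A0; lia.
Qed.

Lemma primitive_split k A : is_form k A ->
  exists B C, [/\ primitive k B, form_sub 2 k C & A = B + L C].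
Proof.
move=> fA; have : exists e, iter (n.+1 - k + e) L A = 0.
  by exists (2 * n).+1; apply: (iterL_gt fA); lia.
case=> e; elim: e A fA => [|e IH] A fA.
  rewrite addn0 => A0; exists A, 0; split; last by rewrite L0 addr0.
    by rewrite /primitive; case: ifP => kn //; move: A0;
      rewrite (_ : (n.+1 - k = 0)%N) //; lia.
  exact: form_sub0.
rewrite addnS; set t := (n.+1 - k + e)%N => A0.
have := Lam_iterL t fA; rewrite A0 linear0; set c := (_ * _) => /esym /eqP.
rewrite addr_eq0 => /eqP LtA.
have c0 : c != 0.
  rewrite /c mulf_eq0 pnatr_eq0 /= -addrA -opprD -natrD subr_eq0 eqr_nat /t; lia.
have fL := Lam_form_sub fA.
have f1 : is_form k (A + c^-1 *: L (Lam A)).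
  apply/is_formD/is_formZ => //.
  by have := form_sub_iterL (t := 1) fL isT; rewrite addnK.
have [|B [C [pB fC E]]] := IH _ f1.
  by rewrite iterLD iterLZ -iterSr LtA scalerN scalerA mulVf // scale1r subrr.
exists B, (C - c^-1 *: Lam A); split => //.
  by apply/form_subD/form_subN/form_subZ.
by rewrite LB LZ addrA -E addrK.
Qed.

(* The sum runs over all r: the components outside the Lefschetz range are 0. *)
Lemma is_lefschetz_sum k A (B : nat -> form_field M) N : (k./2 < N)%N ->
  (forall r, ~~ (k - n <= r <= k./2)%N -> B r = 0) ->
  A = \sum_(k - n <= r < k./2.+1) iter r L (B r) <-> A = \sum_(r < N) iter r L (B r).
Proof.
move=> kN B0; suff -> : \sum_(k - n <= r < k./2.+1) iter r L (B r) = \sum_(r < N) iter r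
  L (B r) by [].
rewrite (big_nat_widen _ _ N) // (big_nat_widenl _ 0%N) // big_mkord big_mkcond /=.
apply: eq_bigr => r _; case: ifP => // rk; rewrite B0 ?iterL0 //.
by move: rk => /= rk; lia.
Qed.

Lemma lefschetz_ex k A : is_form k A -> exists B : nat -> form_field M,
  is_lefschetz k A B.
Proof.
elim/ltn_ind: k A => k IH A fA; have [B [C [pB fC E]]] := primitive_split fA.
have [B' [pB' B'0 CE]] : exists B' : nat -> form_field M, [/\ forall r,
  (k - n <= r.+1 <= k./2)%N -> primitive (k - 2 * r.+1) (B' r),
    forall r, ~~ (k - n <= r.+1 <= k./2)%N -> B' r = 0 & L C = \sum_(r < k) iter r.+1 L
      (B' r)].
  move: fC; rewrite /form_sub; case: ifP => k2; last first.
    move=> ->; exists (fun=> 0); split => // [r _|]; first exact: primitive0.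
    by rewrite L0 big1 // => r _; rewrite iterL0.
  move=> /IH [|B' [pB' B'0 CE]]; first by lia.
  exists (fun r => if (k - n <= r.+1)%N then B' r else 0); split => [r|r nr|].
  - move=> /andP[kr rk]; rewrite kr; have -> : (k - 2 * r.+1 = k - 2 - 2 * r)%N by lia.
    by apply: pB'; lia.
  - by case: ifP => // kr; apply: B'0; lia.
  - have -> : L C = \sum_(r < k) iter r.+1 L (B' r).
      by rewrite (proj1 (@is_lefschetz_sum (k - 2) C B' k ltac:(lia) B'0) CE) L_sum;
        apply: eq_bigr => r _; rewrite iterS.
    apply: eq_bigr => r _; case: ifP => // kr; rewrite iterL0.
    have [rr|rr] := boolP (k - 2 - n <= r <= (k - 2)./2)%N; last by rewrite B'0 // iterL0.
    by apply: primitive_iterL (pB' _ rr) _; lia.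
exists (fun r => if r is r'.+1 then B' r' else B); split => [[|r] rk|[|r] rk|].
- by rewrite muln0 subn0.
- exact: pB'.
- by move: pB; rewrite /primitive ifF //; lia.
- exact: B'0.
- apply/(@is_lefschetz_sum k _ _ k.+1); first by lia.
    move=> [|r] rk; last exact: B'0.
    by move: pB; rewrite /primitive ifF //; lia.
  by rewrite big_ord_recl E CE.
Qed.

Lemma lefschetz_low_unique k (B : nat -> form_field M) : (k <= n)%N -> is_lefschetz k 0 B
  -> B = fun=> 0.
Proof.
elim/ltn_ind: k B => k IH B kn [pB B0 E].
move: E => /(@is_lefschetz_sum k 0 B k.+1 ltac:(lia) B0).
have p0 : primitive k (B 0%N) by have := pB 0%N; rewrite muln0 subn0; apply; lia.
rewrite big_ord_recl /=.
have -> : \sum_(i < k) L (iter i L (B (bump 0 i))) = L (\sum_(i < k) iter i L (B i.+1)).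
  by rewrite L_sum.
set C := \sum_(i < k) _ => E.
have C0 : C = 0.
  have [k2|k2] := leqP 2 k; last first.
    rewrite /C big1 // => i _; rewrite B0 ?iterL0 //; have := ltn_ord i; lia.
  have fC : is_form (k - 2) C.
    apply: is_form_sum => i _; have [ik|ik] := boolP (i.+1 <= k./2)%N.
      have -> : (k - 2 = k - 2 * i.+1 + 2 * i)%N by lia.
      by apply: is_form_iterL; apply: primitive_form; apply: pB; lia.
    by rewrite B0 ?iterL0; [exact: is_form0|lia].
  apply: (iterL_inj (t := (n.+2 - k)%N) fC); first lia.
  have := congr1 (iter (n.+1 - k) L) E.
  rewrite iterL0 iterLD (primitive_iterL p0) ?add0r; last by lia.
  by rewrite -iterSr (_ : (n.+1 - k).+1 = n.+2 - k)%N //; lia.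
have B00 : B 0%N = 0 by move: E; rewrite C0 L0 addr0.
apply/funext => -[|r] //.
have [k2|k2] := leqP 2 k; last by rewrite B0 //; lia.
have := IH (k - 2)%N _ (fun r => B r.+1) _ _.
move=> /(_ ltac:(lia) ltac:(lia)) H; apply: (congr1 (fun f => f r) (H _)).
split => [i ik|i ik|].
- have -> : (k - 2 - 2 * i = k - 2 * i.+1)%N by lia.
  by apply: pB; lia.
- by apply: B0; lia.
- apply/(@is_lefschetz_sum _ _ _ k); [lia|by move=> i ik; apply: B0; lia|].
  by rewrite -/C C0.
Qed.

Lemma lefschetz_unique0 k (B : nat -> form_field M) : is_lefschetz k 0 B -> B = fun=> 0.
Proof.
have [kn|kn] := leqP k n; first exact: lefschetz_low_unique.
move=> [pB B0 E].
have [k2|k2] := leqP k (2 * n); last by apply/funext => r; apply: B0; lia.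
pose B' r := B (r + (k - n))%N.
have E' : 0 = iter (k - n) L (\sum_((2 * n - k) - n <= r < (2 * n - k)./2.+1) iter r L
  (B' r)).
  rewrite iterL_sum (_ : (2 * n - k - n = 0)%N); last by lia.
  have kE : k./2.+1 = ((2 * n - k)./2.+1 + (k - n))%N by lia.
  rewrite [LHS]E kE -{1}[(k - n)%N]add0n big_addn addnK; apply: eq_bigr => r _.
  by rewrite iterL_add [(k - n + _)%N]addnC.
have fC : is_form (2 * n - k) (\sum_((2 * n - k) - n <= r < (2 * n - k)./2.+1) iter r L
  (B' r)).
  rewrite big_nat; apply: is_form_sum => r rk.
  have -> : (2 * n - k = (k - 2 * (r + (k - n))) + 2 * r)%N by lia.
  by apply/is_form_iterL/primitive_form/pB; lia.
have C0 := iterL_inj fC _ (esym E'); have {}C0 := C0 ltac:(lia).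
have B'0 : B' = fun=> 0.
  apply: (@lefschetz_low_unique (2 * n - k)%N); first lia.
  split => [r rk|r rk|//].
  - have -> : (2 * n - k - 2 * r = k - 2 * (r + (k - n)))%N by lia.
    by apply: pB; lia.
  - by apply: B0; lia.
apply/funext => r; have [kr|kr] := leqP (k - n) r; last by apply: B0; lia.
by rewrite -(subnK kr) -[LHS]/(B' _) B'0.
Qed.

Lemma is_lefschetzP k (a : R) A A' (B B' : nat -> form_field M) : is_lefschetz k A B ->
  is_lefschetz k A' B' ->
  is_lefschetz k (a *: A + A') (fun r => a *: B r + B' r).
Proof.
move=> [pB B0 ->] [pB' B'0 ->]; split => [r rk|r rk|].
- by apply: primitiveP; [exact: pB|exact: pB'].
- by rewrite B0 // B'0 // scaler0 addr0.
- rewrite scaler_sumr -big_split; apply: eq_bigr => r _.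
  by rewrite /= iterLD iterLZ.
Qed.

Lemma lefschetz_unique k A (B B' : nat -> form_field M) : is_lefschetz k A B ->
  is_lefschetz k A B' -> B = B'.
Proof.
move=> lB lB'; have := is_lefschetzP (-1) lB lB';
  rewrite scaleN1r addNr => /lefschetz_unique0 E.
apply/funext => r; have := congr1 (fun f => f r) E; rewrite /= scaleN1r addrC => /eqP.
by rewrite subr_eq0 => /eqP.
Qed.

Lemma lefschetzP k A : is_form k A -> is_lefschetz k A (lefschetz k A).
Proof.
move=> fA; have [B lB] := lefschetz_ex fA; rewrite /lefschetz;
  case: xgetP => [C _ //|noC].
by case: (noC B).
Qed.

Lemma lefschetzE k A (B : nat -> form_field M) : is_lefschetz k A B -> lefschetz k A = B.
Proof.
move=> lB; rewrite /lefschetz; case: xgetP => [C _ lC|noC];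
  first exact: lefschetz_unique lC lB.
by case: (noC B).
Qed.

Lemma lefschetz_linear k (a : R) A A' : is_form k A -> is_form k A' ->
  lefschetz k (a *: A + A') = fun r => a *: lefschetz k A r + lefschetz k A' r.
Proof. by move=> fA fA'; apply/lefschetzE/is_lefschetzP; exact: lefschetzP. Qed.

Lemma is_lefschetz_basis s r B : (s + r <= n)%N -> primitive s B ->
  is_lefschetz (s + 2 * r) (iter r L B) (fun i => if i == r then B else 0).
Proof.
move=> sr pB; split => [i _|i|].
- by case: eqP => [->|_]; [rewrite addnK|exact: primitive0].
- by case: eqP => [->|//]; lia.
- apply/(@is_lefschetz_sum _ _ _ (s + r).+1); first by lia.
    by move=> i; case: eqP => [->|//]; lia.
  have rN : (r < (s + r).+1)%N by lia.
  rewrite (bigD1 (Ordinal rN)) //= eqxx big1 ?addr0 // => i ir.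
  by rewrite ifF ?iterL0 //; apply: contraNF ir => /eqP ir; apply/eqP/val_inj.
Qed.

Lemma lefschetz_basis s r B : (s + r <= n)%N -> primitive s B ->
  lefschetz (s + 2 * r) (iter r L B) = fun i => if i == r then B else 0.
Proof. by move=> sr pB; apply/lefschetzE/is_lefschetz_basis. Qed.

Lemma lefschetz_ind k (P : form_field M -> Prop) :
  P 0 -> (forall A B, is_form k A -> is_form k B -> P A -> P B -> P (A + B)) ->
  (forall s r B, k = (s + 2 * r)%N -> (s + r <= n)%N -> primitive s B -> P (iter r L B))
    ->
  forall A, is_form k A -> P A.
Proof.
move=> P0 PD PB A /lefschetzP[pB _ ->].
suff [] : is_form k (\sum_(k - n <= r < k./2.+1) iter r L (lefschetz k A r)) /\
    P (\sum_(k - n <= r < k./2.+1) iter r L (lefschetz k A r)) by [].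
rewrite big_nat; apply: (big_ind (fun A => is_form k A /\ P A)) =>
  [|B C [fB pB'] [fC pC]|r rk].
- by split => //; exact: is_form0.
- by split; [exact: is_formD|exact: PD].
have kE : k = (k - 2 * r + 2 * r)%N by lia.
have pr : primitive (k - 2 * r) (lefschetz k A r) by apply: pB; lia.
split; first by rewrite {1}kE; exact/is_form_iterL/primitive_form.
by apply: PB kE _ pr; lia.
Qed.

(* Common shape of rstar, Lneg and Pi: keep the components satisfying c and replace L^r by
   L^(e r). *)
Definition lefschetz_op (c : pred nat) (e : nat -> nat) k A : form_field M :=
  \sum_(k - n <= r < k./2.+1 | c r) iter (e r) L (lefschetz k A r).

Lemma lefschetz_opP c e k (a : R) A B : is_form k A -> is_form k B ->
  lefschetz_op c e k (a *: A + B) = a *: lefschetz_op c e k A + lefschetz_op c e k B.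
Proof.
move=> fA fB; rewrite /lefschetz_op lefschetz_linear // scaler_sumr -big_split.
by apply: eq_bigr => r _; rewrite /= iterLD iterLZ.
Qed.

Lemma lefschetz_op0 c e k : lefschetz_op c e k 0 = 0.
Proof.
have f0 : is_form k (0 : form_field M) := is_form0 k.
by have := lefschetz_opP c e (-1) f0 f0; rewrite scaler0 addr0 scaleN1r addNr.
Qed.

Lemma lefschetz_op_basis c e s r B : (s + r <= n)%N -> primitive s B ->
  lefschetz_op c e (s + 2 * r) (iter r L B) = if c r then iter (e r) L B else 0.
Proof.
move=> sr pB; rewrite /lefschetz_op lefschetz_basis //.
have rr : (s + 2 * r - n <= r < (s + 2 * r)./2.+1)%N by lia.
rewrite big_mkcond /= (bigD1_seq r) ?mem_index_iota ?iota_uniq //= eqxx big1 ?addr0 // =>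
  i ir.
by case: ifP => // _; rewrite (negPf ir) iterL0.
Qed.

Lemma rstarP k (a : R) A B : is_form k A -> is_form k B ->
  rstar k (a *: A + B) = a *: rstar k A + rstar k B.
Proof. exact: (lefschetz_opP xpredT (fun r => n - r - (k - 2 * r))%N). Qed.

Lemma LnegP q k (a : R) A B : is_form k A -> is_form k B ->
  Lneg q k (a *: A + B) = a *: Lneg q k A + Lneg q k B.
Proof. exact: (lefschetz_opP (fun r => q <= r)%N (fun r => r - q)%N). Qed.

Lemma PiP p k (a : R) A B : is_form k A -> is_form k B ->
  Pi p k (a *: A + B) = a *: Pi p k A + Pi p k B.
Proof. exact: (lefschetz_opP (fun r => r <= p)%N id). Qed.

Lemma rstar0 k : rstar k (0 : form_field M) = 0.
Proof. exact: (lefschetz_op0 xpredT (fun r => n - r - (k - 2 * r))%N). Qed.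

Lemma Lneg0 q k : Lneg q k (0 : form_field M) = 0.
Proof. exact: (lefschetz_op0 (fun r => q <= r)%N (fun r => r - q)%N). Qed.

Lemma Pi0 p k : Pi p k (0 : form_field M) = 0.
Proof. exact: (lefschetz_op0 (fun r => r <= p)%N id). Qed.

Lemma rstar_basis s r B : (s + r <= n)%N -> primitive s B ->
  rstar (s + 2 * r) (iter r L B) = iter (n - r - s) L B.
Proof.
move=> sr pB; have := lefschetz_op_basis xpredT (fun i =>
  n - i - (s + 2 * r - 2 * i))%N sr pB.
by rewrite addnK.
Qed.

Lemma Lneg_basis q s r B : (s + r <= n)%N -> primitive s B ->
  Lneg q (s + 2 * r) (iter r L B) = if (q <= r)%N then iter (r - q) L B else 0.
Proof. exact: (lefschetz_op_basis (fun r => q <= r)%N (fun r => r - q)%N). Qed.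

Lemma Pi_basis p s r B : (s + r <= n)%N -> primitive s B ->
  Pi p (s + 2 * r) (iter r L B) = if (r <= p)%N then iter r L B else 0.
Proof. exact: (lefschetz_op_basis (fun r => r <= p)%N id). Qed.

End LefschetzTheory.

(** * Reflection, negative powers and projections *)

Section FilteredForms.
Context {R : realType} {n : nat} {M : symplectic_manifold R n}.
Implicit Types (A B C : form_field M) (k s r t p q e m j : nat).

Definition form_linear k (T : form_field M -> form_field M) :=
  forall (a : R) A B, is_form k A -> is_form k B -> T (a *: A + B) = a *: T A + T B.

Lemma form_linear0 k T : form_linear k T -> T 0 = 0.
Proof.
move=> lT; have f0 : is_form k (0 : form_field M) := is_form0 k.
by have := lT (-1) _ _ f0 f0; rewrite scaler0 addr0 scaleN1r addNr.
Qed.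

Lemma form_linearD k T A B : form_linear k T -> is_form k A -> is_form k B ->
  T (A + B) = T A + T B.
Proof. by move=> lT fA fB; have := lT 1 _ _ fA fB; rewrite !scale1r. Qed.

Lemma form_linearZ k T (a : R) A : form_linear k T -> is_form k A -> T (a *: A) = a *: T
  A.
Proof.
by move=> lT fA; have := lT a _ _ fA (is_form0 k); rewrite !addr0 (form_linear0 lT) addr0.
Qed.

Lemma form_linearN k T A : form_linear k T -> is_form k A -> T (- A) = - T A.
Proof. by move=> lT fA; have := form_linearZ (-1) lT fA; rewrite !scaleN1r. Qed.

Lemma form_linearB k T A B : form_linear k T -> is_form k A -> is_form k B ->
  T (A - B) = T A - T B.
Proof.
move=> lT fA fB; rewrite (form_linearD lT) // ?(form_linearN lT) //.
exact: is_formN.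
Qed.

Lemma form_linear_d k : form_linear k d.
Proof. by move=> a A B; exact: dP. Qed.

Lemma form_linear_rstar k : form_linear k (rstar k).
Proof. by move=> a A B; exact: rstarP. Qed.

Lemma form_linear_Lneg q k : form_linear k (Lneg q k).
Proof. by move=> a A B; exact: LnegP. Qed.

Lemma form_linear_Pi p k : form_linear k (Pi p k).
Proof. by move=> a A B; exact: PiP. Qed.

Lemma d0 : d (0 : form_field M) = 0.
Proof. exact: (form_linear0 (@form_linear_d 0)). Qed.

Lemma is_form_rstar k A : (k <= 2 * n)%N -> is_form k A -> is_form (2 * n - k) (rstar k
  A).
Proof.
move=> k2; move: A; apply: (@lefschetz_ind R n M k) =>
  [|A' B fA fB IHA IHB|s r B kE sr pB].
- by rewrite rstar0; exact: is_form0.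
- by rewrite (form_linearD (@form_linear_rstar k)) //; exact: is_formD.
rewrite kE rstar_basis //; have -> : (2 * n - (s + 2 * r) = s + 2 * (n - r - s))%N by lia.
exact/is_form_iterL/primitive_form.
Qed.

Lemma form_sub_Lneg q k A : is_form k A -> form_sub (2 * q) k (Lneg q k A).
Proof.
move: A; apply: (@lefschetz_ind R n M k) => [|A' B fA fB IHA IHB|s r B kE sr pB].
- by rewrite Lneg0; exact: form_sub0.
- by rewrite (form_linearD (@form_linear_Lneg q k)) //; exact: form_subD.
rewrite kE Lneg_basis //; case: ifP => qr; last exact: form_sub0.
rewrite /form_sub ifT; last lia.
have -> : (s + 2 * r - 2 * q = s + 2 * (r - q))%N by lia.
exact/is_form_iterL/primitive_form.
Qed.

Lemma is_form_Pi p k A : is_form k A -> is_form k (Pi p k A).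
Proof.
move: A; apply: (@lefschetz_ind R n M k) => [|A' B fA fB IHA IHB|s r B kE sr pB].
- by rewrite Pi0; exact: is_form0.
- by rewrite (form_linearD (@form_linear_Pi p k)) //; exact: is_formD.
rewrite kE Pi_basis //; case: ifP => _; last exact: is_form0.
exact/is_form_iterL/primitive_form.
Qed.

Lemma Pi_Lneg p k A : is_form k A -> Pi p k A + iter p.+1 L (Lneg p.+1 k A) = A.
Proof.
move: A; apply: (@lefschetz_ind R n M k) => [|A' B fA fB IHA IHB|s r B kE sr pB].
- by rewrite Pi0 Lneg0 iterL0 addr0.
- rewrite (form_linearD (@form_linear_Pi p k)) //
  (form_linearD (@form_linear_Lneg p.+1 k)) //.
  by rewrite iterLD addrACA IHA IHB.
rewrite kE Pi_basis // Lneg_basis //; case: leqP => rp; first by rewrite iterL0 addr0.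
by rewrite add0r iterL_add subnKC.
Qed.

Lemma Pi_iterL p k C : form_sub (2 * p.+1) k C -> Pi p k (iter p.+1 L C) = 0.
Proof.
rewrite /form_sub; case: ifP => pk; last by move=> ->; rewrite iterL0 Pi0.
have kE : k = (k - 2 * p.+1 + 2 * p.+1)%N by rewrite subnK.
have fL C' : is_form (k - 2 * p.+1) C' -> is_form k (iter p.+1 L C').
  by move=> fC; rewrite kE; exact: is_form_iterL.
move: C; apply: (@lefschetz_ind R n M (k - 2 * p.+1)) =>
  [|A' B fA fB IHA IHB|s r B sE sr pB].
- by rewrite iterL0 Pi0.
- by rewrite iterLD (form_linearD (@form_linear_Pi p k)) ?IHA ?IHB ?addr0 //; exact: fL.
rewrite iterL_add; have [rs|rs] := leqP (s + (p.+1 + r)) n; last first.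
  by rewrite (primitive_iterL pB) ?Pi0 //; lia.
have -> : k = (s + 2 * (p.+1 + r))%N by lia.
by rewrite Pi_basis // ifF //; lia.
Qed.

Lemma rstarK k A : (k <= 2 * n)%N -> is_form k A -> rstar (2 * n - k) (rstar k A) = A.
Proof.
move=> k2; move: A; apply: (@lefschetz_ind R n M k) =>
  [|A' B fA fB IHA IHB|s r B kE sr pB].
- by rewrite !rstar0.
- rewrite (form_linearD (@form_linear_rstar k)) //.
  by rewrite (form_linearD (@form_linear_rstar (2 * n - k))) ?IHA ?IHB //;
    exact: is_form_rstar.
rewrite kE rstar_basis //; have -> : (2 * n - (s + 2 * r) = s + 2 * (n - r - s))%N by lia.
by rewrite rstar_basis //; [congr (iter _ _ _); lia|lia].
Qed.

Lemma Pi_high p k A : (n + p < k)%N -> is_form k A -> Pi p k A = 0.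
Proof.
move=> pk; move: A; apply: (@lefschetz_ind R n M k) =>
  [|A' B fA fB IHA IHB|s r B kE sr pB].
- exact: Pi0.
- by rewrite (form_linearD (@form_linear_Pi p k)) // IHA IHB addr0.
by rewrite kE Pi_basis // ifF //; lia.
Qed.

(* The projection onto the kernel of L^(p+1) along the Lefschetz decomposition. *)
Definition Pi_ker p k A : form_field M :=
  rstar (2 * n - k) (Pi p (2 * n - k) (rstar k A)).

Lemma form_linear_Pi_ker p k : (k <= 2 * n)%N -> form_linear k (Pi_ker p k).
Proof.
move=> k2 a A B fA fB; rewrite /Pi_ker rstarP // PiP ?rstarP //;
  by do ?[apply: is_form_Pi|apply: is_form_rstar].
Qed.

Lemma Pi_kerE p k A : (k <= 2 * n)%N -> is_form k A ->
  Pi_ker p k A = A - Lneg p.+1 (k + 2 * p.+1) (iter p.+1 L A).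
Proof.
move=> k2; move: A; apply: (@lefschetz_ind R n M k) =>
  [|A' B fA fB IHA IHB|s r B kE sr pB].
- by rewrite iterL0 Lneg0 subr0 (form_linear0 (form_linear_Pi_ker p k2)).
- rewrite (form_linearD (form_linear_Pi_ker p k2)) // IHA IHB iterLD.
  rewrite (form_linearD (@form_linear_Lneg p.+1 (k + 2 * p.+1))) ?opprD 1?addrACA //;
    exact: is_form_iterL.
rewrite /Pi_ker kE rstar_basis // iterL_add.
have -> : (2 * n - (s + 2 * r) = s + 2 * (n - r - s))%N by lia.
have srn : (s + (n - r - s) <= n)%N by lia.
rewrite Pi_basis //; have [rp|rp] := leqP (n - r - s) p.
  rewrite rstar_basis // [iter (p.+1 + r) _ _](primitive_iterL pB) ?Lneg0 ?subr0;
    last by lia.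
  by congr (iter _ _ _); lia.
have -> : (s + 2 * r + 2 * p.+1 = s + 2 * (p.+1 + r))%N by lia.
rewrite Lneg_basis //; last by lia.
by rewrite leq_addr addKn subrr rstar0.
Qed.

Lemma is_form_Pi_ker p k A : (k <= 2 * n)%N -> is_form k A -> is_form k (Pi_ker p k A).
Proof.
move=> k2 fA; have -> : is_form k = @is_form _ _ M (2 * n - (2 * n - k)) by rewrite subKn.
by apply/is_form_rstar/is_form_Pi/is_form_rstar => //; lia.
Qed.

Lemma iterL_Pi_ker p k A : (k <= 2 * n)%N -> is_form k A -> iter p.+1 L (Pi_ker p k A) =
  0.
Proof.
move=> k2 fA; rewrite Pi_kerE // iterLB.
have := Pi_Lneg p (is_form_iterL p.+1 fA); rewrite Pi_iterL ?add0r => [->|].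
  exact: subrr.
by rewrite /form_sub leq_addl addnK.
Qed.

Lemma Pi_rstar_ker p k A : (k <= 2 * n)%N -> is_form k A -> iter p.+1 L A = 0 ->
  Pi p (2 * n - k) (rstar k A) = rstar k A.
Proof.
move=> k2 fA A0; have := Pi_kerE p k2 fA; rewrite A0 Lneg0 subr0 => E.
have fP : is_form (2 * n - k) (Pi p (2 * n - k) (rstar k A)) by
  exact/is_form_Pi/is_form_rstar.
have := rstarK (leq_subr _ _) fP; rewrite subKn //.
by rewrite -[rstar (2 * n - k) _]/(Pi_ker p k A) E.
Qed.

Lemma Lneg_iterL p k C : form_sub (2 * p.+1) k C -> (k <= 2 * n + 2 * p.+1)%N ->
  Lneg p.+1 k (iter p.+1 L C) = C - Pi_ker p (k - 2 * p.+1) C.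
Proof.
rewrite /form_sub => + k2; case: ifP => pk fC.
  by rewrite Pi_kerE ?subnK ?opprB 1?addrC ?subrK //; lia.
rewrite fC iterL0 Lneg0 (form_linear0 (form_linear_Pi_ker p _)) ?subr0 //; lia.
Qed.

Lemma Lneg_iterL_low p k C : form_sub (2 * p.+1) k C -> (k < n + p + 2)%N -> (p <= n)%N ->
  Lneg p.+1 k (iter p.+1 L C) = C.
Proof.
move=> fC kn pn; rewrite Lneg_iterL //; last lia.
move: fC; rewrite /form_sub; case: ifP => pk fC; last first.
  by rewrite fC (form_linear0 (form_linear_Pi_ker p _)) ?subr0 //; lia.
rewrite /Pi_ker Pi_high ?rstar0 ?subr0 //; first lia.
by apply: is_form_rstar => //; lia.
Qed.

Lemma wedge0l A : wedge 0 A = 0.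
Proof. exact: (linear0 (wedger A)). Qed.

Lemma d_iterL k t A : is_form k A -> d (iter t L A) = iter t L (d A).
Proof.
move=> fA; elim: t => [//|t IH]; rewrite !iterS -IH.
rewrite (d_wedge is_form_omega (is_form_iterL t fA)) (symplectic_closed (omega_symplectic
  M)).
rewrite wedge0l add0r sqrrN expr1n scale1r //.
Qed.

Lemma d_iterL_sub e k t A : form_sub e k A -> d (iter t L A) = iter t L (d A).
Proof.
by rewrite /form_sub; case: ifP => _ fA; [exact: d_iterL fA|rewrite fA d0 !iterL0 d0].
Qed.

Lemma form_sub_d e k A : form_sub e k A -> form_sub e k.+1 (d A).
Proof.
rewrite /form_sub; case: ifP => ek fA.
  by rewrite ifT ?subSn //; [exact: is_form_d|lia].
by rewrite fA d0; exact: form_sub0.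
Qed.

Lemma form_sub_dd e k A : form_sub e k A -> d (d A) = 0.
Proof. by rewrite /form_sub; case: ifP => _ fA; [exact: d_d fA|rewrite fA !d0]. Qed.

Lemma form_sub_wedgel e j k A B : form_sub e j A -> is_form k B -> form_sub e (j + k)
  (wedge A B).
Proof.
rewrite /form_sub => + fB; case: ifP => ej fA.
  rewrite ifT; last lia.
  have -> : (j + k - e = j - e + k)%N by lia.
  exact: is_form_wedge.
rewrite fA wedge0l; exact: form_sub0.
Qed.

Lemma form_sub_wedger e j k A B : is_form j A -> form_sub e k B -> form_sub e (j + k)
  (wedge A B).
Proof.
rewrite /form_sub => fA; case: ifP => ek fB.
  rewrite ifT; last lia.
  by rewrite -addnBA //; exact: is_form_wedge.
rewrite fB linear0; exact: form_sub0.
Qed.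

Lemma wedge_iterLl t A B : wedge (iter t L A) B = iter t L (wedge A B).
Proof. by elim: t => [//|t IH]; rewrite !iterS -IH /L wedgeA. Qed.

Lemma wedge_iterLr t k A B : is_form k A -> wedge A (iter t L B) = iter t L (wedge A B).
Proof.
move=> fA; elim: t => [//|t IH]; rewrite !iterS -IH /L !wedgeA.
by rewrite (wedgeC is_form_omega fA) exprM sqrrN !expr1n scale1r.
Qed.

Lemma wedge_iterLr_sub t e k A B : form_sub e k A -> wedge A (iter t L B) = iter t L
  (wedge A B).
Proof.
rewrite /form_sub; case: ifP => _ fA; first exact: wedge_iterLr fA.
by rewrite fA !wedge0l iterL0.
Qed.

Lemma filtered_form p k A : filtered p k A -> is_form k A.
Proof. by case=> A' fA' ->; exact: is_form_Pi. Qed.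

Lemma Pi_top p A : (p <= n)%N -> is_form (n + p) A ->
  exists2 B, primitive (n - p) B & Pi p (n + p) A = iter p L B.
Proof.
move=> pn; move: A; apply: (@lefschetz_ind R n M (n + p)) =>
  [|A' B fA fB [A1 pA EA] [B1 pB EB]|s r B kE sr pB].
- by exists 0; [exact: primitive0|rewrite Pi0 iterL0].
- exists (A1 + B1); first by rewrite -[A1]scale1r; exact: primitiveP.
  by rewrite (form_linearD (@form_linear_Pi p (n + p))) // EA EB iterLD.
rewrite kE Pi_basis //; case: ifP => rp; last by exists 0;
  [exact: primitive0|rewrite iterL0].
have rE : r = p by lia.
have sE : s = (n - p)%N by lia.
by exists B; [rewrite -sE|rewrite rE].
Qed.

Lemma dsplit_ex s B : (s <= n)%N -> primitive s B -> exists XY, is_dsplit s B XY.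
Proof.
move=> sn pB; have fB := primitive_form pB.
have [X [C [pX fC E]]] := primitive_split (is_form_d fB).
have dB0 : iter (n.+1 - s) L (d B) = 0.
  by rewrite -(d_iterL _ fB) (primitive_iterL pB) ?d0 //; lia.
case: s sn pB fB pX fC dB0 => [|s] sn pB fB pX fC dB0.
  by exists (X, C); split => //=; rewrite /form_sub /= in fC; rewrite fC.
move: fC; rewrite /form_sub /= subSS subSS subn0 => fC.
have [Y [W [pY fW EC]]] := primitive_split fC.
suff W0 : W = 0 by exists (X, Y); split => //=; rewrite E EC W0 L0 addr0.
move: fW; rewrite /form_sub; case: ifP => // s2 fW.
apply: (iterL_inj (t := (n.+1 - s.+1).+2) fW); first lia.
move: dB0; rewrite E EC LD iterLD iterLD (primitive_iterL pX) ?add0r; last by lia.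
by rewrite -!iterSr (primitive_iterL pY) ?add0r //; lia.
Qed.

Lemma dsplit_unique s B XY XY' : (s <= n)%N ->
  is_dsplit s B XY -> is_dsplit s B XY' -> XY = XY'.
Proof.
case: XY XY' => [X Y] [X' Y'] sn [/= pX pY E] [/= pX' pY' E'].
have pXX : primitive s.+1 (X - X') by rewrite addrC -scaleN1r; exact: primitiveP.
have pYY : if s is s'.+1 then primitive s' (Y - Y') else Y - Y' = 0.
  case: s sn {pX pX' pXX E E'} pY pY' => [|s] sn pY pY'; first by rewrite pY pY' subrr.
  by rewrite addrC -scaleN1r; exact: primitiveP.
have E0 : 0 = (X - X') + L (Y - Y').
  by rewrite LB addrACA -opprD -E -E' subrr.
have pY1 : (0 < s)%N -> primitive (s.+1 - 2 * 1) (Y - Y').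
  by move: pYY; case: (s) => // s' pYY _; rewrite (_ : (s'.+2 - 2 * 1 = s')%N) //; lia.
have Y0 : s = 0%N -> Y - Y' = 0 by move: pYY; case: (s).
have X0 : (n <= s)%N -> X - X' = 0 by move=> ns; move: pXX; rewrite /primitive ifF //;
  lia.
have lB : is_lefschetz s.+1 0 (fun r =>
  if r is r'.+1 then if r' is 0 then Y - Y' else 0 else X - X').
  split => [[|[|r]] rs|[|[|r]] rs //|].
  - by rewrite muln0 subn0.
  - by apply: pY1; lia.
  - exact: primitive0.
  - by apply: X0; lia.
  - by apply: Y0; lia.
  - apply/(@is_lefschetz_sum _ _ _ _ _ _ s.+2); [lia| |].
      by move=> [|[|r]] rs //; [apply: X0|apply: Y0]; lia.
    by rewrite !big_ord_recl big1 ?addr0 // => i _; rewrite iterL0.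
have U := lefschetz_unique0 lB.
have /eqP := congr1 (fun f => f 0%N) U; rewrite subr_eq0 => /eqP ->.
by have /eqP := congr1 (fun f => f 1%N) U; rewrite subr_eq0 => /eqP ->.
Qed.

Lemma dsplitP s B : (s <= n)%N -> primitive s B -> is_dsplit s B (dsplit s B).
Proof.
move=> sn pB; have [XY dXY] := dsplit_ex sn pB.
by rewrite /dsplit; case: xgetP => [XY' _ //|no]; case: (no XY).
Qed.

Lemma dsplitE s B XY : (s <= n)%N -> is_dsplit s B XY -> dsplit s B = XY.
Proof.
move=> sn dXY; rewrite /dsplit; case: xgetP => [XY' _ dXY'|no]; last by case: (no XY).
exact: dsplit_unique dXY' dXY.
Qed.

Lemma dsplit0 s : (s <= n)%N -> dsplit s (0 : form_field M) = (0, 0).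
Proof.
move=> sn; apply: dsplitE => //; split => /=; first exact: primitive0.
  by case: s sn => // s _; exact: primitive0.
by rewrite d0 linear0 addr0.
Qed.

Lemma partial_plus_basis s r B : (s + r <= n)%N -> primitive s B ->
  partial_plus (s + 2 * r) (iter r L B) = iter r L (dsplit s B).1.
Proof.
move=> sr pB; rewrite /partial_plus lefschetz_basis //.
have rr : (s + 2 * r - n <= r < (s + 2 * r)./2.+1)%N by lia.
rewrite (eq_big_nat _ _ (F2 := fun i => if i == r then iter r L (dsplit s B).1 else 0)) =>
  [|i ik].
  rewrite (bigD1_seq r) ?mem_index_iota ?iota_uniq //= eqxx big1 ?addr0 // => i ir.
  by rewrite (negPf ir).
case: eqP => [->|_]; first by rewrite addnK.
by rewrite dsplit0 /= ?iterL0 //; lia.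
Qed.

Lemma partial_minus_basis s r B : (s + r <= n)%N -> primitive s B ->
  partial_minus (s + 2 * r) (iter r L B) = iter r L (dsplit s B).2.
Proof.
move=> sr pB; rewrite /partial_minus lefschetz_basis //.
have rr : (s + 2 * r - n <= r < (s + 2 * r)./2.+1)%N by lia.
rewrite (eq_big_nat _ _ (F2 := fun i => if i == r then iter r L (dsplit s B).2 else 0)) =>
  [|i ik].
  rewrite (bigD1_seq r) ?mem_index_iota ?iota_uniq //= eqxx big1 ?addr0 // => i ir.
  by rewrite (negPf ir).
case: eqP => [->|_]; first by rewrite addnK.
by rewrite dsplit0 /= ?iterL0 //; lia.
Qed.

End FilteredForms.

(** * The cone of the (p+1)-st power of L *)

Section Cone.
Context {R : realType} {n : nat} {M : symplectic_manifold R n} {p : nat}.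
Hypothesis hp : (p <= n)%N.
Implicit Types (A B C a b : form_field M) (k j m : nat).

Lemma partial_plus0 k : partial_plus k (0 : form_field M) = 0.
Proof.
have l0 : lefschetz k (0 : form_field M) = fun=> 0.
  apply: lefschetzE; split => [r _|//|]; first exact: primitive0.
  by rewrite big1 // => r _; rewrite iterL0.
rewrite /partial_plus l0 big_nat big1 // => r rk.
by rewrite dsplit0 ?iterL0 //; lia.
Qed.

Lemma partial_plus_minus_top A : filtered p (n + p) A ->
  partial_plus (n + p).-1 (partial_minus (n + p) A) =
  rstar (n - p) (d (Lneg p.+1 (n + p).+1 (d A))).
Proof.
case=> a fa EA; have [B pB EB] := Pi_top hp fa; rewrite EA EB {a fa A EA EB}.
have fB := primitive_form pB.
have [pX pY dB] := dsplitP (leq_subr p n) pB; set XY := dsplit _ _ in pX pY dB *.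
have dA : d (iter p L B) = iter p.+1 L XY.2.
  rewrite (d_iterL p fB) dB iterLD (primitive_iterL pX) ?add0r; last by lia.
  by rewrite -[wedge _ _]/(L _) -iterSr.
have -> : partial_minus (n + p) (iter p L B) = iter p L XY.2.
  have -> : (n + p = (n - p) + 2 * p)%N by lia.
  by rewrite partial_minus_basis //; lia.
have ddA : iter p.+1 L (d XY.2) = 0.
  have fA := is_form_iterL p fB.
  have := d_d fA; rewrite dA.
  suff -> : d (iter p.+1 L XY.2) = iter p.+1 L (d XY.2) by [].
  move: pY; case: (n - p)%N => [->|s pY]; first by rewrite d0 !iterL0 d0.
  exact: d_iterL (primitive_form pY).
rewrite dA; move: pY; case sE: (n - p)%N => [|s] pY.
  by rewrite pY !iterL0 partial_plus0 Lneg0 d0 rstar0.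
have -> : ((n + p).-1 = s + 2 * p)%N by lia.
have -> : ((n + p).+1 = s + 2 * p.+1)%N by lia.
rewrite partial_plus_basis //; last by lia.
rewrite Lneg_basis ?leqnn ?subnn //; last by lia.
have pdY : primitive s.+1 (d XY.2).
  rewrite /primitive ifT; last by lia.
  split; first exact/is_form_d/primitive_form.
  by have -> : (n.+1 - s.+1 = p.+1)%N by lia.
have -> : dsplit s XY.2 = (d XY.2, 0).
  apply: dsplitE; first lia.
  split => //=; first by case: (s) => // s'; exact: primitive0.
  by rewrite linear0 addr0.
have E : rstar s.+1 (d XY.2) = iter (n - 0 - s.+1) L (d XY.2).
  by have := rstar_basis (r := 0) _ pdY; rewrite ?muln0 ?addn0; apply; lia.
by rewrite E; congr (iter _ _ _); lia.
Qed.

(* The pair (a, b) stands for a + theta b, whose differential is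
   (d a + L^(p+1) b, - d b). *)
Definition cone_proj m a b : form_field M :=
  if (m <= n + p)%N then Pi p m a
  else - Pi p (bardeg n p m) (rstar (m - (2 * p + 1)) (b + d (Lneg p.+1 m a))).

Lemma form_sub_is_form k e A : (e <= k)%N -> form_sub e k A -> is_form (k - e) A.
Proof. by rewrite /form_sub => ->. Qed.

Lemma cone_proj_form m a b : (n + p < m)%N -> is_form m a -> form_sub (2 * p.+1) m.+1 b ->
  is_form (m - (2 * p + 1)) (b + d (Lneg p.+1 m a)).
Proof.
move=> pm fa fb; have -> : (m - (2 * p + 1) = m.+1 - 2 * p.+1)%N by lia.
apply: form_sub_is_form; first lia.
exact/form_subD/form_sub_d/form_sub_Lneg.
Qed.

Lemma cone_projP m (c : R) a b a' b' : (m <= 2 * n + 2 * p + 1)%N ->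
  is_form m a -> form_sub (2 * p.+1) m.+1 b -> is_form m a' -> form_sub (2 * p.+1) m.+1
    b' ->
  cone_proj m (c *: a + a') (c *: b + b') = c *: cone_proj m a b + cone_proj m a' b'.
Proof.
move=> mn fa fb fa' fb'; rewrite /cone_proj; case: leqP => pm;
  first exact: form_linear_Pi.
have fy := cone_proj_form pm fa fb; have fy' := cone_proj_form pm fa' fb'.
have dQ : d (Lneg p.+1 m (c *: a + a')) = c *: d (Lneg p.+1 m a) + d (Lneg p.+1 m a').
  have pm2 : (2 * p.+1 <= m.+1)%N by lia.
  rewrite LnegP //; have := form_sub_Lneg p.+1 fa; have := form_sub_Lneg p.+1 fa'.
  rewrite /form_sub; case: ifP => _ f1 f2; first exact: form_linear_d f2 f1.
  by rewrite f1 f2 scaler0 addr0 d0 scaler0 addr0.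
rewrite dQ addrACA -scalerDr rstarP // scalerN -opprD; congr (- _).
have bE : (bardeg n p m = 2 * n - (m - (2 * p + 1)))%N by rewrite /bardeg; lia.
by rewrite bE; apply: form_linear_Pi; apply: is_form_rstar => //; lia.
Qed.

Lemma cone_split m a b : is_form m a -> form_sub (2 * p.+1) m.+1 b ->
  d a + iter p.+1 L b = d (Pi p m a) + iter p.+1 L (b + d (Lneg p.+1 m a)).
Proof.
move=> fa fb; have fQ := form_sub_Lneg p.+1 fa.
rewrite -{1}(Pi_Lneg p fa) (form_linearD (@form_linear_d _ _ M m)).
- by rewrite (d_iterL_sub _ fQ) iterLD -addrA [X in _ + X]addrC.
- exact: is_form_Pi.
- by have := form_sub_iterL (t := p.+1) fQ (leqnn _); rewrite addnK.
Qed.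

Lemma cone_proj_chain_low m a b : (m < n + p)%N ->
  is_form m a -> form_sub (2 * p.+1) m.+1 b ->
  d_plus p m (cone_proj m a b) = cone_proj m.+1 (d a + iter p.+1 L b) (- d b).
Proof.
move=> mnp fa fb; rewrite /cone_proj mnp ltnW // /d_plus (cone_split fa fb).
have fy : form_sub (2 * p.+1) m.+1 (b + d (Lneg p.+1 m a)).
  exact/form_subD/form_sub_d/form_sub_Lneg.
rewrite (form_linearD (@form_linear_Pi _ _ M p m.+1)) ?(Pi_iterL fy) ?addr0 //.
  exact/is_form_d/is_form_Pi.
by have := form_sub_iterL (t := p.+1) fy (leqnn _); rewrite addnK.
Qed.

Lemma cone_proj_chain_top a b : is_form (n + p) a -> form_sub (2 * p.+1) (n + p).+1 b ->
  - partial_plus (n + p).-1 (partial_minus (n + p) (cone_proj (n + p) a b)) =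
  cone_proj (n + p).+1 (d a + iter p.+1 L b) (- d b).
Proof.
move=> fa fb; rewrite /cone_proj leqnn ltnn (cone_split fa fb).
have fA : filtered p (n + p) (Pi p (n + p) a) by exists a.
rewrite partial_plus_minus_top //; set A := Pi p (n + p) a in fA *.
have fA' := filtered_form fA.
set W := Lneg p.+1 (n + p).+1 (d A).
have fW : form_sub (2 * p.+1) (n + p).+1 W by exact/form_sub_Lneg/is_form_d.
have dA : d A = iter p.+1 L W.
  by have := Pi_Lneg p (is_form_d fA'); rewrite Pi_high ?add0r //; exact: is_form_d.
have fQ := form_sub_Lneg p.+1 fa.
have fy : form_sub (2 * p.+1) (n + p).+1 (b + d (Lneg p.+1 (n + p) a)).
  exact/form_subD/form_sub_d.
rewrite dA -iterLD Lneg_iterL_low //; [|exact: form_subD|lia].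
have dlin B C : form_sub (2 * p.+1) (n + p).+1 B -> form_sub (2 * p.+1) (n + p).+1 C ->
    d (B + C) = d B + d C.
  rewrite /form_sub; case: ifP => _ fB fC; first exact: form_linearD (@form_linear_d _ _
    M _) fB fC.
  by rewrite fB fC d0 !addr0 d0.
rewrite (dlin _ _ fW fy) (dlin _ _ fb (form_sub_d fQ)) (form_sub_dd fQ) addr0 addrCA
  addNr addr0.
have -> : ((n + p).+1 - (2 * p + 1) = n - p)%N by lia.
have -> : bardeg n p (n + p).+1 = (2 * n - (n - p))%N by rewrite /bardeg; lia.
congr (- _); rewrite Pi_rstar_ker //; first lia.
  have := form_sub_d fW; rewrite /form_sub ifT; last lia.
  by have -> : ((n + p).+2 - 2 * p.+1 = n - p)%N by lia.
by rewrite -(d_iterL_sub _ fW) -dA (d_d fA').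
Qed.

Lemma cone_proj_chain_high m a b : (n + p < m)%N -> (m <= 2 * n + 2 * p)%N ->
  is_form m a -> form_sub (2 * p.+1) m.+1 b ->
  - d_minus (bardeg n p m) (cone_proj m a b) = cone_proj m.+1 (d a + iter p.+1 L b) (- d
    b).
Proof.
move=> pm mn fa fb.
have E1 : (m <= n + p)%N = false by lia.
have E2 : (m.+1 <= n + p)%N = false by lia.
rewrite /cone_proj E1 E2.
rewrite (cone_split fa fb) (Pi_high pm fa) d0 add0r.
have fy := cone_proj_form pm fa fb; set y := b + _ in fy *.
pose k := (m - (2 * p + 1))%N; rewrite -/k in fy *.
have k2 : (k < 2 * n)%N by rewrite /k; lia.
have kE : (m.+1 - 2 * p.+1 = k)%N by rewrite /k; lia.
have sy : form_sub (2 * p.+1) m.+1 y by rewrite /form_sub ifT ?kE //; lia.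
have fQ := form_sub_Lneg p.+1 fa.
rewrite (Lneg_iterL sy) ?kE; last lia.
set K := Pi_ker p k y.
have fK : is_form k K by apply: is_form_Pi_ker => //; exact: ltnW.
have fb' : is_form k b by move: fb; rewrite /form_sub ifT ?kE //; lia.
have dy : d y = d b.
  have fdQ : is_form k (d (Lneg p.+1 m a)).
    by move: (form_sub_d fQ); rewrite /form_sub ifT ?kE //; lia.
  by rewrite /y (form_linearD (@form_linear_d _ _ M k)) // (form_sub_dd fQ) addr0.
rewrite (form_linearB (@form_linear_d _ _ M k)) // dy addrA addNr add0r.
have -> : (m.+1 - (2 * p + 1) = k.+1)%N by rewrite /k; lia.
have -> : bardeg n p m.+1 = (2 * n - k.+1)%N by rewrite /bardeg /k; lia.
have bE : bardeg n p m = (2 * n - k)%N by rewrite /bardeg /k; lia.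
have fr : is_form (2 * n - k) (Pi p (2 * n - k) (rstar k y)).
  by apply/is_form_Pi/is_form_rstar => //; exact: ltnW.
rewrite /d_minus bE (form_linearN (@form_linear_rstar _ _ M _)) //.
rewrite -[rstar (2 * n - k) _]/K subKn; last exact: ltnW.
rewrite (form_linearN (@form_linear_d _ _ M k)) //
  !(form_linearN (@form_linear_rstar _ _ M k.+1)) ?opprK;
  [|exact: is_form_d..].
rewrite (form_linearN (@form_linear_Pi _ _ M p _)) ?opprK; last by apply: is_form_rstar;
  [lia|exact: is_form_d].
rewrite Pi_rstar_ker //; first exact: is_form_d.
by rewrite -(d_iterL _ fK) iterL_Pi_ker ?d0 //; exact: ltnW.
Qed.

Section Product.
Context {j k : nat} {A B : form_field M}.
Hypotheses (hj : (j <= n + p)%N) (hk : (k <= n + p)%N).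
Hypotheses (hA : filtered p j A) (hB : filtered p k B).

Let fA : is_form j A. Proof. exact: filtered_form hA. Qed.
Let fB : is_form k B. Proof. exact: filtered_form hB. Qed.
Let A' := Pi p j.+1 (d A).
Let B' := Pi p k.+1 (d B).
Let U := Lneg p.+1 j.+1 (d A).
Let V := Lneg p.+1 k.+1 (d B).
Let fU : form_sub (2 * p.+1) j.+1 U. Proof. exact/form_sub_Lneg/is_form_d. Qed.
Let fV : form_sub (2 * p.+1) k.+1 V. Proof. exact/form_sub_Lneg/is_form_d. Qed.
Let fA' : is_form j.+1 A'. Proof. exact/is_form_Pi/is_form_d. Qed.
Let fB' : is_form k.+1 B'. Proof. exact/is_form_Pi/is_form_d. Qed.
Let dA : d A = A' + iter p.+1 L U. Proof. by rewrite Pi_Lneg //; exact: is_form_d. Qed.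
Let dB : d B = B' + iter p.+1 L V. Proof. by rewrite Pi_Lneg //; exact: is_form_d. Qed.

Lemma Lneg_d_Pi_d i C : (i < n + p)%N -> is_form i C ->
  Lneg p.+1 i.+2 (d (Pi p i.+1 (d C))) = - d (Lneg p.+1 i.+1 (d C)).
Proof.
move=> ip fC; have fQ := form_sub_Lneg p.+1 (is_form_d fC).
have E : d (Pi p i.+1 (d C)) = iter p.+1 L (- d (Lneg p.+1 i.+1 (d C))).
  have -> : Pi p i.+1 (d C) = d C - iter p.+1 L (Lneg p.+1 i.+1 (d C)).
    by rewrite -{2}(Pi_Lneg p (is_form_d fC)) addrK.
  rewrite (form_linearB (@form_linear_d _ _ M i.+1)).
  - by rewrite (d_d fC) sub0r (d_iterL_sub _ fQ) iterLN.
  - exact: is_form_d.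
  - by have := form_sub_iterL (t := p.+1) fQ (leqnn _); rewrite addnK.
by rewrite E Lneg_iterL_low //; [exact/form_subN/form_sub_d|lia].
Qed.

Lemma dF_top C : filtered p (n + p) C ->
  [/\ rstar (n + p) (dF p (n + p) C) = - d (Lneg p.+1 (n + p).+1 (d C)),
      Pi p (n + p).+1 (d C) = 0 & iter p.+1 L (d (Lneg p.+1 (n + p).+1 (d C))) = 0].
Proof.
move=> fC; have fC' := filtered_form fC; have fdC := is_form_d fC'.
have P0 : Pi p (n + p).+1 (d C) = 0 by rewrite Pi_high.
have fQ := form_sub_Lneg p.+1 fdC; split => //; last first.
  rewrite -(d_iterL_sub _ fQ); have := Pi_Lneg p fdC; rewrite P0 add0r => ->.
  exact: d_d fC'.
rewrite /dF ltnn partial_plus_minus_top //.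
have fdQ : is_form (n - p) (d (Lneg p.+1 (n + p).+1 (d C))).
  have := form_sub_d fQ; rewrite /form_sub ifT; last lia.
  by have -> : ((n + p).+2 - 2 * p.+1 = n - p)%N by lia.
set dQ := d (Lneg _ _ _) in fdQ *.
have -> : (n + p = 2 * n - (n - p))%N by lia.
rewrite (form_linearN (@form_linear_rstar _ _ M _)); last by apply: is_form_rstar; [lia|].
by rewrite rstarK //; lia.
Qed.

Lemma times_cone_proj :
  times p j k A B = cone_proj (j + k) (wedge A B) (- wedge U B - (-1) ^+ j *: wedge A V).
Proof.
rewrite /times hj hk /cone_proj; case: leqP => // jk.
have f1 : form_sub (2 * p.+1) (j + k).+1 (wedge U B) by rewrite -addSn;
  exact: form_sub_wedgel.
have f2 : form_sub (2 * p.+1) (j + k).+1 (wedge A V) by rewrite -addnS;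
  exact: form_sub_wedger.
have fb : form_sub (2 * p.+1) (j + k).+1 (- wedge U B - (-1) ^+ j *: wedge A V).
  by apply: form_subD; apply: form_subN => //; exact: form_subZ.
have fy := cone_proj_form jk (is_form_wedge fA fB) fb.
rewrite -[RHS](form_linearN (@form_linear_Pi _ _ M p _)); last first.
  have -> : bardeg n p (j + k) = (2 * n - (j + k - (2 * p + 1)))%N by rewrite /bardeg;
    lia.
  by apply: is_form_rstar => //; lia.
rewrite -(form_linearN (@form_linear_rstar _ _ M _) fy); congr (Pi _ _ (rstar _ _)).
by rewrite !opprD !opprK [RHS]addrC addrA.
Qed.

Lemma times_dFl : times p j.+1 k (dF p j A) B =
  cone_proj (j + k).+1 (wedge A' B) (wedge (d U) B + (-1) ^+ j *: wedge A' V).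
Proof.
have f1 : form_sub (2 * p.+1) (j + k).+2 (wedge (d U) B).
  by rewrite -!addSn; apply: form_sub_wedgel => //; exact: form_sub_d.
have f2 : form_sub (2 * p.+1) (j + k).+2 (wedge A' V).
  by rewrite -addnS -addSn; exact: form_sub_wedger.
have fb := form_subD f1 (form_subZ ((-1) ^+ j) f2).
have fAB : is_form (j + k).+1 (wedge A' B) by rewrite -addSn; exact: is_form_wedge.
move: hj; rewrite leq_eqVlt => /orP[/eqP jE|jp].
  have E1 : (j.+1 <= n + p)%N = false by lia.
  have E2 : ((j + k).+1 <= n + p)%N = false by lia.
  rewrite /times /cone_proj E1 E2 hk.
  have [r0 P0 K0] := dF_top (C := A) ltac:(rewrite -jE; exact: hA).
  have -> : bardeg n p j.+1 = (n + p)%N by rewrite /bardeg; lia.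
  rewrite -jE in r0 P0 K0 *; rewrite -/U in r0 K0; rewrite -/A' in P0.
  rewrite r0 P0 !wedge0l scaler0 addr0 Lneg0 d0 addr0.
  have fdU : is_form (n - p) (d U).
    have := form_sub_d fU; rewrite /form_sub ifT; last lia.
    by have -> : (j.+2 - 2 * p.+1 = n - p)%N by lia.
  have fW := is_form_wedge fdU fB.
  have -> : wedge (- d U) B = - wedge (d U) B by exact: (linearN (wedger B)).
  have -> : (2 * n - j + k = n - p + k)%N by lia.
  rewrite (form_linearN (@form_linear_rstar _ _ M _) fW).
  have -> : ((j + k).+1 - (2 * p + 1) = n - p + k)%N by lia.
  have -> : bardeg n p (j + k).+1 = (2 * n - (n - p + k))%N by rewrite /bardeg; lia.
  by rewrite Pi_rstar_ker ?wedge_iterLl //; [lia|rewrite -wedge_iterLl K0 wedge0l].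
rewrite /times /cone_proj jp hk /dF jp /d_plus -/A' addSn; case: leqP => // jk.
have fy := cone_proj_form (m := (j + k).+1) jk fAB fb.
rewrite (Lneg_d_Pi_d jp fA) -/U -[RHS](form_linearN (@form_linear_Pi _ _ M p _));
  last first.
  have -> : bardeg n p (j + k).+1 = (2 * n - ((j + k).+1 - (2 * p + 1)))%N by rewrite
    /bardeg; lia.
  by apply: is_form_rstar => //; lia.
rewrite -(form_linearN (@form_linear_rstar _ _ M _) fy); congr (Pi _ _ (rstar _ _)).
have -> : wedge (- d U) B = - wedge (d U) B by exact: (linearN (wedger B)).
by rewrite exprS mulN1r scaleNr !opprD [RHS]addrC addrA.
Qed.

Lemma times_dFr : times p j k.+1 A (dF p k B) =
  cone_proj (j + k).+1 (wedge A B') (- wedge U B' + (-1) ^+ j *: wedge A (d V)).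
Proof.
have f1 : form_sub (2 * p.+1) (j + k).+2 (wedge U B').
  by rewrite -addnS -addSn; exact: form_sub_wedgel.
have f2 : form_sub (2 * p.+1) (j + k).+2 (wedge A (d V)).
  by rewrite -!addnS; apply: form_sub_wedger => //; exact: form_sub_d.
have fb := form_subD (form_subN f1) (form_subZ ((-1) ^+ j) f2).
have fAB : is_form (j + k).+1 (wedge A B') by rewrite -addnS; exact: is_form_wedge.
move: hk; rewrite leq_eqVlt => /orP[/eqP kE|kp].
  have E1 : (k.+1 <= n + p)%N = false by lia.
  have E2 : ((j + k).+1 <= n + p)%N = false by lia.
  rewrite /times /cone_proj hj E1 E2.
  have [r0 P0 K0] := dF_top (C := B) ltac:(rewrite -kE; exact: hB).
  have -> : bardeg n p k.+1 = (n + p)%N by rewrite /bardeg; lia.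
  rewrite -kE in r0 P0 K0 *; rewrite -/V in r0 K0; rewrite -/B' in P0.
  rewrite r0 P0 !linear0 add0r Lneg0 d0 addr0.
  have fdV : is_form (n - p) (d V).
    have := form_sub_d fV; rewrite /form_sub ifT; last lia.
    by have -> : (k.+2 - 2 * p.+1 = n - p)%N by lia.
  have fW := is_form_wedge fA fdV.
  have -> : (j + (2 * n - k) = j + (n - p))%N by lia.
  rewrite linearN (form_linearN (@form_linear_rstar _ _ M _) fW) scalerN.
  have -> : ((j + k).+1 - (2 * p + 1) = j + (n - p))%N by lia.
  have -> : bardeg n p (j + k).+1 = (2 * n - (j + (n - p)))%N by rewrite /bardeg; lia.
  rewrite Pi_rstar_ker.
  - by rewrite (form_linearZ _ (@form_linear_rstar _ _ M _) fW).
  - lia.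
  - exact: is_formZ.
  - by rewrite iterLZ -(wedge_iterLr _ _ fA) K0 linear0 scaler0.
rewrite /times /cone_proj kp hj /dF kp /d_plus -/B' addnS; case: leqP => // jk.
have fy := cone_proj_form (m := (j + k).+1) jk fAB fb.
rewrite (Lneg_d_Pi_d kp fB) -/V -/U -[RHS](form_linearN (@form_linear_Pi _ _ M p _));
  last first.
  have -> : bardeg n p (j + k).+1 = (2 * n - ((j + k).+1 - (2 * p + 1)))%N by rewrite
    /bardeg; lia.
  by apply: is_form_rstar => //; lia.
rewrite -(form_linearN (@form_linear_rstar _ _ M _) fy); congr (Pi _ _ (rstar _ _)).
by rewrite linearN scalerN !opprD opprK [RHS]addrC addrA.
Qed.

Lemma d_cone_wedge :
  d (wedge A B) + iter p.+1 L (- wedge U B - (-1) ^+ j *: wedge A V) =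
  wedge A' B + (-1) ^+ j *: wedge A B'.
Proof.
rewrite (d_wedge fA fB) dA dB.
have -> : wedge (A' + iter p.+1 L U) B = wedge A' B + iter p.+1 L (wedge U B).
  by rewrite -wedge_iterLl; exact: (linearD (wedger B)).
have -> : wedge A (B' + iter p.+1 L V) = wedge A B' + iter p.+1 L (wedge A V).
  by rewrite -(wedge_iterLr _ _ fA); exact: (linearD (wedge A)).
rewrite iterLB iterLN iterLZ scalerDr.
set x := wedge A' B; set y := iter _ _ (wedge U B); set z := _ *: wedge A B';
  set w := _ *: iter _ _ _.
by rewrite addrACA !addrK.
Qed.

Lemma d_cone_wedge_theta :
  - d (- wedge U B - (-1) ^+ j *: wedge A V) =
  (wedge (d U) B + (-1) ^+ j *: wedge A' V) +
  (-1) ^+ j *: (- wedge U B' + (-1) ^+ j *: wedge A (d V)).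
Proof.
have dlin (c : R) X Y : form_sub (2 * p.+1) (j + k).+1 X -> form_sub (2 * p.+1) (j +
  k).+1 Y ->
    d (c *: X + Y) = c *: d X + d Y.
  rewrite /form_sub; case: ifP => _ fX fY; first exact: form_linear_d fX fY.
  by rewrite fX fY !(scaler0, addr0, d0).
have f1 : form_sub (2 * p.+1) (j + k).+1 (wedge U B) by rewrite -addSn;
  exact: form_sub_wedgel.
have f2 : form_sub (2 * p.+1) (j + k).+1 (wedge A V) by rewrite -addnS;
  exact: form_sub_wedger.
have dUB : d (wedge U B) = wedge (d U) B - (-1) ^+ j *: wedge U (d B).
  move: fU; rewrite /form_sub; case: ifP => ij fU'; last first.
    by rewrite fU' !wedge0l d0 wedge0l scaler0 subr0.
  rewrite (d_wedge fU' fB); congr (_ + _); rewrite -scaleNr; congr (_ *: _).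
  have -> : - (-1) ^+ j = (-1) ^+ j.+1 :> R by rewrite exprS mulN1r.
  by rewrite -[LHS]signr_odd -[RHS]signr_odd oddB // mul2n odd_double addbF.
have dAV : d (wedge A V) = wedge (d A) V + (-1) ^+ j *: wedge A (d V).
  move: fV; rewrite /form_sub; case: ifP => ik fV'; first exact: d_wedge fA fV'.
  by rewrite fV' d0 !linear0 d0 addr0.
have UB : wedge U (d B) = wedge U B' + iter p.+1 L (wedge U V).
  by rewrite dB -(wedge_iterLr_sub _ _ fU); exact: (linearD (wedge U)).
have AV : wedge (d A) V = wedge A' V + iter p.+1 L (wedge U V).
  by rewrite dA -wedge_iterLl; exact: (linearD (wedger V)).
have -> : - wedge U B - (-1) ^+ j *: wedge A V = (-1) *: ((-1) ^+ j *: wedge A V + wedge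
  U B) + 0.
  by rewrite addr0 scaleN1r opprD addrC.
rewrite dlin; [|by apply: form_subD => //; exact: form_subZ|exact: form_sub0].
rewrite dlin // d0 addr0 scaleN1r opprK dUB dAV UB AV.
have ee : (-1) ^+ j * (-1) ^+ j = 1 :> R by rewrite -expr2 sqrr_sign.
rewrite !scalerDr !scalerA ee !scale1r scalerN.
set x := wedge A (d V); set y := _ *: wedge A' V; set z := _ *: iter _ _ _.
set u := wedge (d U) B; set v := _ *: wedge U B'.
by rewrite opprD [u + _]addrA [y + z + x]addrAC addrACA subrr addr0 [RHS]addrACA addrC.
Qed.

Lemma cone_leibniz (beta := - wedge U B - (-1) ^+ j *: wedge A V) :
  cone_proj (j + k).+1 (d (wedge A B) + iter p.+1 L beta) (- d beta) =
  times p j.+1 k (dF p j A) B + (-1) ^+ j *: times p j k.+1 A (dF p k B).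
Proof.
rewrite d_cone_wedge d_cone_wedge_theta times_dFl times_dFr [RHS]addrC.
rewrite [wedge A' B + _ in LHS]addrC [_ + (-1) ^+ j *: (- wedge U B' + _)]addrC.
apply: cone_projP; first lia.
- by rewrite -addnS; exact: is_form_wedge.
- apply: form_subD; first by apply: form_subN; rewrite -addnS -addSn;
  exact: form_sub_wedgel.
  by apply: form_subZ; rewrite -!addnS; apply: form_sub_wedger => //; exact: form_sub_d.
- by rewrite -addSn; exact: is_form_wedge.
- apply: form_subD; first by rewrite -!addSn; apply: form_sub_wedgel => //;
  exact: form_sub_d.
  by apply: form_subZ; rewrite -addnS -addSn; exact: form_sub_wedger.
Qed.

Lemma cone_beta_form : form_sub (2 * p.+1) (j + k).+1 (- wedge U B - (-1) ^+ j *: wedge A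
  V).
Proof.
apply: form_subD; apply: form_subN; first by rewrite -addSn; exact: form_sub_wedgel.
by apply: form_subZ; rewrite -addnS; exact: form_sub_wedger.
Qed.

Lemma leibniz_low : (j + k < n + p)%N ->
  d_plus p (j + k) (times p j k A B) =
  times p j.+1 k (dF p j A) B + (-1) ^+ j *: times p j k.+1 A (dF p k B).
Proof.
move=> jk; rewrite -cone_leibniz times_cone_proj.
by apply: cone_proj_chain_low => //; [exact: is_form_wedge|exact: cone_beta_form].
Qed.

Lemma leibniz_top : (j + k = n + p)%N ->
  - partial_plus (n + p).-1 (partial_minus (n + p) (times p j k A B)) =
  times p j.+1 k (dF p j A) B + (-1) ^+ j *: times p j k.+1 A (dF p k B).
Proof.
move=> jk; rewrite -cone_leibniz times_cone_proj.
have := cone_proj_chain_top (a := wedge A B) (b := - wedge U B - (-1) ^+ j *: wedge A V).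
by rewrite -jk; apply; [exact: is_form_wedge|exact: cone_beta_form].
Qed.

Lemma leibniz_high : (n + p < j + k)%N ->
  - d_minus (bardeg n p (j + k)) (times p j k A B) =
  times p j.+1 k (dF p j A) B + (-1) ^+ j *: times p j k.+1 A (dF p k B).
Proof.
move=> jk; rewrite -cone_leibniz times_cone_proj.
by apply: cone_proj_chain_high => //; [lia|exact: is_form_wedge|exact: cone_beta_form].
Qed.

Lemma leibniz_bar : (j <= k)%N ->
  - d_minus (k - j) (times p j (bardeg n p k) A B) =
  times p j.+1 (bardeg n p k) (dF p j A) B
  + (-1) ^+ j *: times p j (bardeg n p k).+1 A (- d_minus k B).
Proof.
move=> jk; pose b := rstar k B.
have k2 : (k <= 2 * n)%N by lia.
have fb : is_form (2 * n - k) b by exact: is_form_rstar.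
have b0 : iter p.+1 L b = 0.
  case: hB => B0 fB0 BE.
  have := iterL_Pi_ker p (leq_subr k (2 * n)) (is_form_rstar k2 fB0).
  by rewrite /Pi_ker subKn // (rstarK k2 fB0) -BE.
have fAb := is_form_wedge fA fb; have fdAb := is_form_wedge (is_form_d fA) fb.
have fAdb := is_form_wedge fA (is_form_d fb).
have E1 : (bardeg n p k <= n + p)%N = false by rewrite /bardeg; lia.
have E2 : bardeg n p (bardeg n p k) = k by rewrite /bardeg; lia.
have E3 : ((bardeg n p k).+1 <= n + p)%N = false by lia.
have lhsE : - d_minus (k - j) (times p j (bardeg n p k) A B) =
    - ((-1) ^+ j *: rstar (j + (2 * n - k)).+1 (d (wedge A b))).
  rewrite /times hj E1 E2 /d_minus -/b.
  rewrite (form_linearZ _ (@form_linear_rstar _ _ M (k - j))); last first.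
    have -> : (k - j = 2 * n - (j + (2 * n - k)))%N by lia.
    by apply: is_form_rstar => //; lia.
  have -> : (k - j = 2 * n - (j + (2 * n - k)))%N by lia.
  rewrite rstarK //; last lia.
  rewrite (form_linearZ _ (@form_linear_d _ _ M _) fAb).
  rewrite subKn; last lia.
  by rewrite (form_linearZ _ (@form_linear_rstar _ _ M _)) //; exact: is_form_d.
have dAb : wedge (d A) b = wedge A' b.
  have -> : wedge (d A) b = wedge A' b + wedge (iter p.+1 L U) b.
    by rewrite dA; exact: (linearD (wedger b)).
  by rewrite wedge_iterLl -(wedge_iterLr_sub _ _ fU) b0 linear0 addr0.
have left : times p j.+1 (bardeg n p k) (dF p j A) B =
    - ((-1) ^+ j *: rstar (j + (2 * n - k)).+1 (wedge (d A) b)).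
  rewrite /times E1; have [jp|jp] := leqP j.+1 (n + p).
    by rewrite E2 -/b /dF jp /d_plus -/A' dAb exprS mulN1r scaleNr addSn.
  rewrite dAb; suff -> : A' = 0 by rewrite wedge0l rstar0 scaler0 oppr0.
  by apply: Pi_high => //; exact: is_form_d.
have right : times p j (bardeg n p k).+1 A (- d_minus k B) =
    - ((-1) ^+ j *: rstar (j + (2 * n - k)).+1 (wedge A (d b))).
  rewrite /times hj E3; case: (posnP k) => [k0|kpos].
    have db0 : d b = 0 by apply: (is_form_gt _ (is_form_d fb)); lia.
    have wA0 : wedge A 0 = 0 by exact: (linear0 (wedge A)).
    by rewrite /d_minus -/b db0 !wA0 !(rstar0, oppr0, wA0, scaler0).
  have -> : bardeg n p (bardeg n p k).+1 = k.-1 by rewrite /bardeg; lia.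
  have fdb := is_form_d fb.
  have fr : is_form k.-1 (rstar (2 * n - k).+1 (d b)).
    have -> : k.-1 = (2 * n - (2 * n - k).+1)%N by lia.
    by apply: is_form_rstar => //; lia.
  rewrite /d_minus -/b (form_linearN (@form_linear_rstar _ _ M _) fr).
  have -> : k.-1 = (2 * n - (2 * n - k).+1)%N by lia.
  rewrite rstarK //; last lia.
  have -> : wedge A (- d b) = - wedge A (d b) by exact: (linearN (wedge A)).
  rewrite subKn; last lia.
  by rewrite (form_linearN (@form_linear_rstar _ _ M _) fAdb) scalerN addnS.
rewrite lhsE left right (d_wedge fA fb).
have fAdb' : is_form (j + (2 * n - k)).+1 (wedge A (d b)) by rewrite -addnS.
rewrite (form_linearD (@form_linear_rstar _ _ M _) fdAb (is_formZ _ fAdb')).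
rewrite (form_linearZ _ (@form_linear_rstar _ _ M _) fAdb').
by rewrite scalerDr scalerN opprD.
Qed.

End Product.
End Cone.

Unset Implicit Arguments.

Theorem theorem5p3 (R : realType) (n : nat) (M : symplectic_manifold R n)
    (p : nat) (hp : (p <= n)%N) (j k : nat)
    (hj : (j <= n + p)%N) (hk : (k <= n + p)%N)
    (Aj Ak Bk : form_field M)
    (hAj : filtered p j Aj) (hAk : filtered p k Ak) (hBk : filtered p k Bk) :
  [/\ (j + k < n + p)%N ->
        d_plus p (j + k) (times p j k Aj Ak)
        = times p j.+1 k (dF p j Aj) Ak
          + (-1) ^+ j *: times p j k.+1 Aj (dF p k Ak),
      (j + k = n + p)%N ->
        - partial_plus (n + p).-1 (partial_minus (n + p) (times p j k Aj Ak))
        = times p j.+1 k (dF p j Aj) Ak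
          + (-1) ^+ j *: times p j k.+1 Aj (dF p k Ak),
      (n + p < j + k)%N ->
        - d_minus (bardeg n p (j + k)) (times p j k Aj Ak)
        = times p j.+1 k (dF p j Aj) Ak
          + (-1) ^+ j *: times p j k.+1 Aj (dF p k Ak)
    & (j <= k)%N ->
        - d_minus (k - j) (times p j (bardeg n p k) Aj Bk)
        = times p j.+1 (bardeg n p k) (dF p j Aj) Bk
          + (-1) ^+ j *: times p j (bardeg n p k).+1 Aj
              (- d_minus k Bk)].
Proof.
split.
- exact: leibniz_low.
- exact: leibniz_top.
- exact: leibniz_high.
- exact: leibniz_bar.
Qed.
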